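(* Let $q\ge1$ be an integer, with $q=2\gamma$ ($\gamma\ge1$) or $q=2\gamma+1$ ($\gamma\ge0$), and let $\theta_0,\theta_1,\dots,\theta_\gamma$ be real constants all different from $\tfrac12$. For a periodic, sufficiently smooth function $w$ on $\Omega$, let $$\Pi w=\begin{cases}\big(D_{h,\theta_\gamma}^{-1}\cdots D_{h,\theta_1}^{-1}\big)\big(D_{h,1-\theta_1}^{-1}\cdots D_{h,1-\theta_\gamma}^{-1}\big)\Pi_0\partial_x^qw+\dfrac{\langle w,1\rangle}{\langle1,1\rangle},&q=2\gamma,\\[2mm]\big(D_{h,\theta_\gamma}^{-1}\cdots D_{h,\theta_1}^{-1}\big)D_{h,\theta_0}^{-1}\big(D_{h,1-\theta_1}^{-1}\cdots D_{h,1-\theta_\gamma}^{-1}\big)\Pi_0\partial_x^qw+\dfrac{\langle w,1\rangle}{\langle1,1\rangle},&q=2\gamma+1.\end{cases}$$ Then $$\|w-\Pi w\|\le C\|w\|_{k+1+q}\,h^{k+1},$$ with a constant $C$ independent of $h$ and $w$.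
   Context: Let $\Omega=\bigcup_{j=1}^NI_j$, $I_j=[x_{j-1/2},x_{j+1/2}]$, be a quasi-uniform partition (mesh size $h$) of a bounded interval with periodic boundary condition ($x_{1/2}$ and $x_{N+1/2}$ identified). $\langle\cdot,\cdot\rangle$ and $\|\cdot\|$ are the $L^2(\Omega)$ inner product and norm, $\|\cdot\|_i$ is the $H^i(\Omega)$ Sobolev norm. $V_h=\{v_h\in L^2(\Omega):v_h|_{I_j}\in P^k(I_j)\ \forall j\}$ with $P^k$ the polynomials of degree at most $k$ ($k\ge0$). $v_h^\mp$ denote left/right limits at cell interfaces and $[v_h]=v_h^+-v_h^-$. $\Pi_0:L^2(\Omega)\to V_h$ is the $L^2$ projection. For $\theta\in\mathbb{R}$, $D_{h,\theta}:V_h\to V_h$ is defined by $$\langle D_{h,\theta}w_h,v_h\rangle=-\langle w_h,\partial_xv_h\rangle-\sum_{j=1}^N(\widehat{w_h})_{j+1/2}[v_h]_{j+1/2}\quad\forall w_h,v_h\in V_h,\qquad \widehat{w_h}=\theta w_h^-+(1-\theta)w_h^+,$$ with $\partial_xv_h$ taken cellwise. Let $Z_h=\{z_h\in V_h:\langle z_h,1\rangle=0\}$. For $\theta\ne\tfrac12$, $D_{h,\theta}$ restricts to a bijection of $Z_h$ onto itself, and $D_{h,\theta}^{-1}:Z_h\to Z_h$ denotes the inverse of this restriction. For $q\ge1$ and periodic $w$, $\Pi_0\partial_x^qw\in Z_h$. *)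

(* Defs.v *)
From HB Require Import structures.
From mathcomp Require Import all_boot all_order all_algebra.
From mathcomp Require Import all_classical all_reals all_analysis.

Set Implicit Arguments.
Unset Strict Implicit.
Unset Printing Implicit Defensive.

Import Order.TTheory GRing.Theory Num.Theory.
Import numFieldNormedType.Exports.

Local Open Scope classical_set_scope.
Local Open Scope ring_scope.

Section Sobolev.
Context {R : realType}.
Variables a b : R.

Definition inner (f g : R -> R) : R :=
  \int[lebesgue_measure]_(x in `[a, b]) (f x * g x).

Definition l2norm (f : R -> R) : R := Num.sqrt (inner f f).

Definition square_integrable (f : R -> R) : Prop :=
  measurable_fun `[a, b] f /\
  lebesgue_measure.-integrable `[a, b] (fun x => (f x ^+ 2)%:E).

(* f is absolutely continuous, periodic, and has derivative g. *)
Definition periodic_primitive (f g : R -> R) : Prop :=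
  f a = f b /\
  forall x, x \in `[a, b] ->
    f x = f a + \int[lebesgue_measure]_(t in `[a, x]) g t.

(* w belongs to the periodic space H^m and dw i is its i-th derivative.  For
   i < m the function dw i is the absolutely continuous representative; dw m
   is only an L^2 function.  Every periodic C^m function w qualifies, with its
   classical derivatives as dw.  The values dw i for i > m are irrelevant. *)
Definition periodic_sobolev (m : nat) (w : R -> R) (dw : nat -> R -> R) : Prop :=
  [/\ dw 0%N = w,
      forall i, (i <= m)%N -> square_integrable (dw i) &
      forall i, (i < m)%N -> periodic_primitive (dw i) (dw i.+1)].

Definition sobolev_norm (m : nat) (dw : nat -> R -> R) : R :=
  Num.sqrt (\sum_(i < m.+1) l2norm (dw i) ^+ 2).

End Sobolev.

Section Mesh.
Context {R : realType}.
Variables (a b : R) (N : nat) (xs : nat -> R).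

(* Cells are numbered from 0: cell i is [xs i, xs i.+1] for i < N. *)
Definition is_mesh : Prop :=
  [/\ xs 0%N = a, xs N = b & forall i, (i < N)%N -> xs i < xs i.+1].

Definition mesh_size : R := \big[Num.max/0]_(i < N) (xs i.+1 - xs i).

Definition quasi_uniform (sigma : R) : Prop :=
  forall i, (i < N)%N -> mesh_size <= sigma * (xs i.+1 - xs i).

End Mesh.

(* The space V_h: one polynomial of degree at most k (size at most k.+1) per
   cell; this fixes an element of L^2 up to its values at the nodes. *)
Notation Vh R k N := {ffun 'I_N -> {poly_(k.+1) R}}.

Section DG.
Context {R : realType}.
Variables (a b : R) (k N : nat) (xs : nat -> R).

Local Notation V := (Vh R k N) (only parsing).
Local Notation "<< f , g >>" := (inner a b f g).

(* The piecewise polynomial function equal to p i on cell i.  Half-open cells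
   only settle the values at the nodes, a null set. *)
Definition pw (p : 'I_N -> {poly R}) (x : R) : R :=
  \sum_(i < N) \1_(`[xs i, xs i.+1[%classic : set R) x * (p i).[x].

Definition vfun (v : V) : R -> R := pw (fun i => v i : {poly R}).

Definition dvfun (v : V) : R -> R := pw (fun i => (v i : {poly R})^`()).

(* One-sided limits at the right end xs i.+1 of cell i.  The limit from the
   right is taken in the next cell ordS i, which for the last cell is cell 0,
   at its left end xs 0: the endpoints a and b are identified. *)
Definition left_lim (v : V) (i : 'I_N) : R := (v i : {poly R}).[xs i.+1].
Definition right_lim (v : V) (i : 'I_N) : R :=
  (v (ordS i) : {poly R}).[xs (ordS i)].
Definition jump (v : V) (i : 'I_N) : R := right_lim v i - left_lim v i.
Definition flux (theta : R) (w : V) (i : 'I_N) : R :=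
  theta * left_lim w i + (1 - theta) * right_lim w i.

(* The element u of V_h, unique when it exists, with <u, v> = L v for all v. *)
Definition riesz (L : V -> R) : V :=
  xget 0 [set u : V | forall v : V, << vfun u, vfun v >> = L v].

Definition Pi0 (w : R -> R) : V := riesz (fun v => << w, vfun v >>).

Definition Dh (theta : R) (w : V) : V :=
  riesz (fun v => - << vfun w, dvfun v >>
                  - \sum_(i < N) flux theta w i * jump v i).

Definition Zh : set V := [set z | << vfun z, cst 1 >> = 0].

(* The inverse of the restriction Zh -> Zh of Dh theta: the element of Zh,
   unique for theta <> 1/2, that Dh theta maps to z. *)
Definition Dinv (theta : R) (z : V) : V :=
  xget 0 [set u : V | Zh u /\ Dh theta u = z].

(* Dinv (1 - theta 1) (... (Dinv (1 - theta g) z)) *)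
Definition Dinv_conj (theta : nat -> R) (g : nat) (z : V) : V :=
  foldr (fun i u => Dinv (1 - theta i) u) z (iota 1 g).

(* Dinv (theta g) (... (Dinv (theta 1) z)) *)
Definition Dinv_prod (theta : nat -> R) (g : nat) (z : V) : V :=
  foldl (fun u i => Dinv (theta i) u) z (iota 1 g).

(* The operator Pi; wq stands for the q-th derivative of w, and gamma = q./2. *)
Definition Pi_op (q : nat) (theta : nat -> R) (w wq : R -> R) (x : R) : R :=
  let z := Dinv_conj theta q./2 (Pi0 wq) in
  vfun (Dinv_prod theta q./2 (if odd q then Dinv (theta 0%N) z else z)) x
  + << w, cst 1 >> / << cst 1, cst 1 >>.

End DG.

(* Main.v *)
Require Import Defs.
From HB Require Import structures.
From mathcomp Require Import all_boot all_order all_algebra.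
From mathcomp Require Import ring lra.
From mathcomp Require Import all_classical all_reals all_analysis.
From mathcomp Require Import measurable_realfun.
Import Order.TTheory GRing.Theory Num.Theory.
Import numFieldNormedType.Exports.

(** Let [z] be a mean-zero element of the discrete space and [Z] its continuous
    piecewise primitive.  Testing [D_theta u = z] cell by cell shows that it
    means: up to an additive constant, [u] is the generalized Gauss-Radau
    projection of [Z], i.e. [u - Z] is orthogonal to the polynomials of degree
    less than [k] on each cell and the flux of [u] equals [Z] at each interface
    ([dgform_of_primitive]).  Inverting [D_theta] thus amounts to integrating,
    projecting, and removing the mean.

    This is stable in the sup norm, uniformly in the mesh.  The projection
    differs from the cellwise L2 projection by a multiple [c_i] of a Legendre
    polynomial on each cell; as that polynomial has values of equal modulus at
    the two ends of its cell, the flux conditions form the cyclic system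
    [theta c_i + (1 - theta) s c_(i+1) = r_i] with [s = 1] or [s = -1], which is
    strictly diagonally dominant exactly because [theta <> 1/2]
    ([gauss_radau]).  Uniqueness of the inverse follows from solvability for
    [1 - theta], since the adjoint of [D_theta] is [- D_(1 - theta)]
    ([dgform_skew], [Dinv_eq]).

    If [Z] is within [O(h^(k+1))] of [w - w(a)], then [Z] is within
    [O(h^(k+1))] of the local Taylor polynomials of [w - w(a)]; the projection
    reproduces these and moves the remainder by [O(h^(k+1))], so the inverse
    operator returns [w] minus its mean up to [O(h^(k+1))] ([inverse_step]).  If
    [w] is itself the derivative of a periodic function, its mean vanishes, and
    integrating once more leads back to the same situation one derivative
    lower ([primitive_error], [Dinv_chain]).

    At the start, [w] having [k + 1 + q] weak derivatives bounds the derivatives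
    of order at most [k + q] uniformly ([derivative_sup]).  For the L2
    projection of the [q]-th derivative this yields only [O(h^k)] pointwise, but
    the primitive of the projection is exact at all nodes, and integrating over
    at most one cell recovers the missing power of [h]
    ([primitive_error_exact_nodes]). *)

Set Implicit Arguments.
Unset Strict Implicit.
Unset Printing Implicit Defensive.

Local Open Scope classical_set_scope.
Local Open Scope ring_scope.

(** * Linear algebra *)

Section LinearAlgebra.
Context {K : fieldType} {V : vectType K}.

Lemma linear_inj_surj (f : V -> V) : linear f -> (forall u, f u = 0 -> u = 0) ->
  forall v, exists u, f u = v.
Proof.
move=> lf injf v.
pose F : {linear V -> V} := HB.pack f (GRing.isLinear.Build _ _ _ _ f lf).
have kerF : lker (linfun F) == 0%VS.
  apply/lker0P => x y; rewrite !lfunE /= => /eqP; rewrite -subr_eq0 => /eqP fxy.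
  apply/eqP; rewrite -subr_eq0; apply/eqP/injf.
  by rewrite -fxy; apply: (linearB F).
by exists ((linfun F)^-1%VF v); rewrite -{2}(lker0_lfunVK kerF v) lfunE.
Qed.

(** The operator [u |-> \sum_i B u e_i *: e_i], for a basis [e], is injective because
    [B] is definite, hence surjective by dimension. *)
Lemma riesz_exists (B : V -> V -> K) (L : V -> K) :
  (forall v, scalar (B^~ v)) -> (forall u, scalar (B u)) -> scalar L ->
  (forall u, B u u = 0 -> u = 0) -> exists u, forall v, B u v = L v.
Proof.
move=> linl linr linL defB.
pose n := \dim {:V}; pose e : n.-tuple V := vbasis {:V}.
have lin_eq (f g : V -> K) : scalar f -> scalar g ->
    (forall i : 'I_n, f e`_i = g e`_i) -> f =1 g.
  move=> lf lg fg v.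
  pose F : {scalar V} := HB.pack f (GRing.isLinear.Build _ _ _ _ f lf).
  pose G : {scalar V} := HB.pack g (GRing.isLinear.Build _ _ _ _ g lg).
  rewrite (coord_vbasis (memvf v)) -[f]/(F : _ -> _) -[g]/(G : _ -> _) !linear_sum.
  by apply: eq_bigr => i _; rewrite !linearZ /= fg.
pose f u : V := \sum_(i < n) B u e`_i *: e`_i.
have lf : linear f.
  move=> a x y; rewrite /f scaler_sumr -big_split /=; apply: eq_bigr => i _.
  by rewrite linl scalerDl scalerA.
have eqL u (M : V -> K) : scalar M -> f u = \sum_(i < n) M e`_i *: e`_i -> B u =1 M.
  move=> lM fuM; apply: lin_eq => // i.
  have fr : free e := basis_free (vbasisP {:V}).
  by have := congr1 (coord e i) fuM; rewrite /f !(coord_sum_free _ _ fr).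
have [u fu] : exists u, f u = \sum_(i < n) L e`_i *: e`_i.
  apply: linear_inj_surj => // u fu0; apply: defB.
  rewrite (eqL u (fun=> 0)) //; first by move=> a x y; rewrite mulr0 addr0.
  by rewrite fu0 big1 // => i _; rewrite scale0r.
by exists u; exact: eqL.
Qed.

End LinearAlgebra.

(** * Antiderivatives and integrals of polynomials *)

Section PolyIntegral.
Context {R : realFieldType}.
Implicit Types p q : {poly R}.

(** The convention [x / 0 = 0] makes the constant coefficient zero. *)
Definition antideriv p : {poly R} := \poly_(i < (size p).+1) (p`_i.-1 / i%:R).

Lemma coef_antideriv p i : (antideriv p)`_i = p`_i.-1 / i%:R.
Proof.
rewrite coef_poly; case: i => [|i] /=; first by rewrite invr0 mulr0.
by rewrite ltnS; case: ltnP => // ?; rewrite nth_default ?mul0r.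
Qed.

Lemma antideriv_linear : linear antideriv.
Proof.
move=> a p q; apply/polyP => i.
by rewrite !(coefD, coefZ, coef_antideriv) mulrDl mulrA.
Qed.
HB.instance Definition _ :=
  GRing.isLinear.Build R {poly R} {poly R} _ antideriv antideriv_linear.

Lemma deriv_antideriv p : (antideriv p)^`() = p.
Proof.
apply/polyP => i; rewrite coef_deriv coef_antideriv -(mulr_natr (_ / _)).
by rewrite divfK ?pnatr_eq0.
Qed.

Lemma size_antideriv_leq p : (size (antideriv p) <= (size p).+1)%N.
Proof. exact: size_poly. Qed.

(** Defining the integral through the antiderivative makes linearity, change of
    variables and integration by parts purely algebraic; [Rintegral_horner]
    identifies it with the Lebesgue integral. *)
Definition pint c d p : R := (antideriv p).[d] - (antideriv p).[c].

Lemma pint_linear c d : scalar (pint c d).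
Proof.
by move=> a p q; rewrite /pint linearP !(hornerD, hornerZ) mulrBr opprD addrACA.
Qed.
HB.instance Definition _ c d :=
  GRing.isLinear.Build R {poly R} R _ (pint c d) (pint_linear c d).


Lemma antideriv_deriv p : antideriv p^`() = p - (p`_0)%:P.
Proof.
apply/polyP => -[|i]; rewrite coef_antideriv coefB coefC /=.
  by rewrite invr0 mulr0 subrr.
by rewrite subr0 coef_deriv -(mulr_natr p`_i.+1) mulfK ?pnatr_eq0.
Qed.

Lemma pint_deriv c d p : pint c d p^`() = p.[d] - p.[c].
Proof. by rewrite /pint antideriv_deriv !hornerE; ring. Qed.

Lemma pint_by_parts c d p q :
  pint c d (p^`() * q) = p.[d] * q.[d] - p.[c] * q.[c] - pint c d (p * q^`()).
Proof. by rewrite -!hornerM -pint_deriv derivM linearD /= addrK. Qed.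

Lemma pintC c d (x : R) : pint c d x%:P = x * (d - c).
Proof.
have -> : x%:P = (x *: 'X)^`() by rewrite derivZ derivX alg_polyC.
by rewrite pint_deriv !hornerE mulrBr.
Qed.

(** The affine maps between a cell [[c, d]] and the reference cell [[0, 1]].  All
    constants below are computed on the latter, hence independent of the mesh. *)
Definition to_ref (c d : R) : {poly R} := (d - c)^-1 *: ('X - c%:P).
Definition of_ref (c d : R) : {poly R} := (d - c) *: 'X + c%:P.

Lemma of_ref_to_ref c d : c < d -> of_ref c d \Po to_ref c d = 'X.
Proof.
move=> cd; rewrite comp_polyD comp_polyZ comp_polyX comp_polyC scalerA.
by rewrite mulfV ?scale1r ?subrK // subr_eq0 gt_eqF.
Qed.

Lemma size_of_ref c d p : c < d -> (size (p \Po of_ref c d) = size p)%N.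
Proof.
move=> cd; apply: size_comp_poly2.
by rewrite size_polyDl size_scale ?size_polyX ?subr_eq0 ?gt_eqF // size_polyC; case: eqP.
Qed.

Lemma size_to_ref c d p : c < d -> (size (p \Po to_ref c d) = size p)%N.
Proof.
move=> cd; apply: size_comp_poly2.
by rewrite size_scale ?size_XsubC // invr_eq0 subr_eq0 gt_eqF.
Qed.

Lemma pint_to_ref c d p : c < d ->
  pint c d (p \Po to_ref c d) = (d - c) * pint 0 1 p.
Proof.
move=> cd; have dc0 : d - c != 0 by rewrite subr_eq0 gt_eqF.
rewrite -{1}(deriv_antideriv p).
have -> : (antideriv p)^`() \Po to_ref c d
   = ((d - c) *: (antideriv p \Po to_ref c d))^`().
  rewrite derivZ deriv_comp /to_ref derivZ derivXsubC alg_polyC mulrC mul_polyC.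
  by rewrite scalerA mulfV // scale1r.
rewrite pint_deriv !hornerZ !horner_comp /to_ref !hornerE subrr mulr0 mulVf //.
by rewrite /pint mulrBr.
Qed.

Lemma norm_horner_le_coefs p x : 0 <= x <= 1 -> `|p.[x]| <= \sum_(i < size p) `|p`_i|.
Proof.
move=> /andP[x0 x1]; rewrite horner_coef (le_trans (ler_norm_sum _ _ _)) //.
apply: ler_sum => i _; rewrite normrM ler_piMr // normrX ger0_norm //.
exact: exprn_ile1.
Qed.

End PolyIntegral.

(** * Cyclic systems with two diagonals *)

Section Circulant.
Context {R : realFieldType} (N : nat) (al be : R).
Hypothesis neq : `|al| != `|be|.

(** Read the equation where [`|c|] is maximal: at that index if [al] is the
    dominant coefficient, at the preceding one if [be] is. *)
Lemma circulant_bound (c r : 'I_N -> R) M :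
  (forall i, al * c i + be * c (ordS i) = r i) -> (forall i, `|r i| <= M) ->
  forall i, `|c i| <= M / `| `|al| - `|be| |.
Proof.
move=> crE rM i.
pose j := [arg max_(j > i) `|c j|]%O.
have jmax m : `|c m| <= `|c j|.
  by rewrite /j; case: Order.TotalTheory.arg_maxP => // l _ /(_ m); apply.
apply: le_trans (jmax i) _.
have pos : 0 < `| `|al| - `|be| | by rewrite normr_gt0 subr_eq0.
rewrite ler_pdivlMr // mulrC.
have dom (u v : R) m : al * c m + be * c (ordS m) = u + v -> `|u| - `|v| <= M.
  move=> E; apply: le_trans (rM m); rewrite -crE E.
  by have := lerB_normD u v.
have [ge|lt] := leP `|be| `|al|.
  rewrite ger0_norm ?subr_ge0 // mulrBl.
  apply: le_trans (dom _ _ j erefl).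
  by rewrite !normrM lerB // ler_wpM2l.
rewrite ltr0_norm ?subr_lt0 // opprB mulrBl.
apply: le_trans (dom _ _ (ord_pred j) (addrC _ _)).
by rewrite !normrM ord_predK lerB // ler_wpM2l.
Qed.

(** The bound with right-hand side zero is injectivity. *)
Lemma circulant_solvable (r : 'I_N -> R) :
  exists c : 'I_N -> R, forall i, al * c i + be * c (ordS i) = r i.
Proof.
pose f (u : 'rV[R]_N) : 'rV[R]_N := \row_i (al * u 0 i + be * u 0 (ordS i)).
have [||u fu] := @linear_inj_surj _ _ f _ _ (\row_i r i).
- by move=> a u v; apply/rowP => i; rewrite !mxE; ring.
- move=> u fu; apply/rowP => i; rewrite mxE; apply/normr0_eq0/le_anti.
  rewrite normr_ge0 andbT.
  have := @circulant_bound (u 0) (fun=> 0) 0; rewrite mul0r; apply => [{}i|_].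
    by have /rowP/(_ i) := fu; rewrite !mxE.
  by rewrite normr0.
- by exists (u 0) => i; have /rowP/(_ i) := fu; rewrite !mxE.
Qed.

End Circulant.

(** * Lebesgue integrals, primitives and Taylor approximation *)

Section Analysis.
Context {R : realType}.
Implicit Types (f g : R -> R) (p q : {poly R}) (c d : R).
Local Notation mu := (@lebesgue_measure R).

(** A class of integrands closed under products that contains polynomials,
    piecewise polynomials and the bounded derivatives of [w]. *)
Definition bounded_measurable (A : set R) g :=
  measurable_fun A g /\ exists M : R, forall x, A x -> `|g x| <= M.

Lemma bounded_measurable_integrable c d g :
  bounded_measurable `[c, d] g -> mu.-integrable `[c, d] (EFin \o g).
Proof.
move=> [mg [M gM]]; apply: measurable_bounded_integrable => //.
  by rewrite /= lebesgue_measure_itv; case: ifP => _; rewrite ltry.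
exists M; split; first exact: num_real.
by move=> y My x /gM; move/le_trans; apply; exact: ltW.
Qed.

Lemma bounded_measurableS (A B : set R) g : measurable A -> B `<=` A ->
  bounded_measurable A g -> bounded_measurable B g.
Proof.
move=> mA BA [mg [M gM]]; split; first exact: measurable_funS mg.
by exists M => x /BA/gM.
Qed.

Lemma bounded_measurableM (A : set R) f g :
  bounded_measurable A f -> bounded_measurable A g ->
  bounded_measurable A (fun x => f x * g x).
Proof.
move=> [mf [M fM]] [mg [K gK]]; split; first exact: measurable_funM.
by exists (M * K) => x Ax; rewrite normrM ler_pM // ?fM ?gK.
Qed.

Lemma bounded_measurableD (A : set R) f g :
  bounded_measurable A f -> bounded_measurable A g ->
  bounded_measurable A (fun x => f x + g x).
Proof.
move=> [mf [M fM]] [mg [K gK]]; split; first exact: measurable_funD.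
by exists (M + K) => x Ax; rewrite (le_trans (ler_normD _ _)) // lerD ?fM ?gK.
Qed.

Lemma bounded_measurable_cst (A : set R) r : bounded_measurable A (fun=> r).
Proof. by split; [exact: measurable_cst | exists `|r|]. Qed.

Lemma bounded_measurableN (A : set R) f :
  bounded_measurable A f -> bounded_measurable A (fun x => - f x).
Proof.
move=> fA; rewrite [X in bounded_measurable A X](_ : _ = (fun x => -1 * f x)).
  exact: bounded_measurableM (bounded_measurable_cst _ _) fA.
by apply/funext => x; rewrite mulN1r.
Qed.

Lemma bounded_measurable_sum (I : Type) (r : seq I) (A : set R) (F : I -> R -> R) :
  (forall i, bounded_measurable A (F i)) ->
  bounded_measurable A (fun x => \sum_(i <- r) F i x).
Proof.
move=> AF; elim: r => [|i r IH].
  by under eq_fun do rewrite big_nil; exact: bounded_measurable_cst.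
by under eq_fun do rewrite big_cons; exact: bounded_measurableD.
Qed.

Lemma bounded_measurable_horner c d p : bounded_measurable `[c, d] (horner p).
Proof.
split.
  apply/measurable_funTS; apply: continuous_measurable_fun.
  exact/continuous_horner.
have : compact (horner p @` `[c, d]).
  apply: continuous_compact; last exact: segment_compact.
  by apply: continuous_subspaceT; exact: continuous_horner.
move=> /compact_bounded[M [_ pM]]; exists (M + 1) => x cdx.
by apply: pM; [rewrite ltrDl | exists x].
Qed.

Lemma integrable_horner c d p : mu.-integrable `[c, d] (EFin \o horner p).
Proof. exact/bounded_measurable_integrable/bounded_measurable_horner. Qed.

Lemma Rintegral_horner c d p : c <= d ->
  \int[mu]_(x in `[c, d]) p.[x] = pint c d p.
Proof.
rewrite le_eqVlt => /predU1P[->|cd].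
  by rewrite set_itv1 Rintegral_set1 /pint subrr.
rewrite /Rintegral (continuous_FTC2 (F := horner (antideriv p))) //.
- by apply: continuous_subspaceT; exact: continuous_horner.
- split; first by move=> x _; exact: derivable_horner.
    by apply: cvg_at_right_filter; exact: continuous_horner.
  by apply: cvg_at_left_filter; exact: continuous_horner.
- by move=> x _; rewrite -derivE deriv_antideriv.
Qed.

Lemma itv_volume c d : c <= d -> fine (mu `[c, d]) = d - c.
Proof.
rewrite le_eqVlt => /predU1P[->|cd].
  by rewrite set_itv1 lebesgue_measure_set1 subrr.
by rewrite lebesgue_measure_itv /= lte_fin cd.
Qed.

Lemma norm_Rintegral_le c d g (M : R) : c <= d -> mu.-integrable `[c, d] (EFin \o g) ->
  (forall x, c <= x <= d -> `|g x| <= M) ->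
  `|\int[mu]_(x in `[c, d]) g x| <= M * (d - c).
Proof.
move=> cd ig gM; apply: le_trans (le_normr_Rintegral _ ig) _ => //.
rewrite -(itv_volume cd) -Rintegral_cst //; apply: le_Rintegral => //.
  by have := integrable_norm ig; apply.
by apply/bounded_measurable_integrable/bounded_measurable_cst.
Qed.

Lemma pint_ge0 c d p : c <= d -> (forall x, 0 <= p.[x]) -> 0 <= pint c d p.
Proof. by move=> cd p0; rewrite -Rintegral_horner // Rintegral_ge0. Qed.

Lemma poly_eq0_on_itv c d p : c < d -> (forall x, c <= x <= d -> p.[x] = 0) -> p = 0.
Proof.
move=> cd p0.
(* Any [size p] distinct points of the interval. *)
pose rs := [seq c + (d - c) / i.+1%:R | i <- iota 0 (size p)].
apply: (@roots_geq_poly_eq0 _ p rs); last by rewrite size_map size_iota.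
  apply/allP => _ /mapP[i _ ->]; apply/rootP/p0.
  have dc : 0 < d - c by rewrite subr_gt0.
  rewrite lerDl divr_ge0 ?(ltW dc) //= -lerBrDl ler_pdivrMr ?ltr0n //.
  by rewrite ler_peMr ?(ltW dc) // ler1n.
rewrite map_inj_uniq ?iota_uniq // => i j /addrI /mulfI.
rewrite subr_eq0 gt_eqF // => /(_ isT)/invr_inj/eqP.
by rewrite eqr_nat => /eqP[].
Qed.

(** A primitive of [p * p] is nondecreasing; if it takes the same value at both
    ends it is constant on the interval, hence a constant polynomial. *)
Lemma pint_sqr_eq0 c d p : c < d -> pint c d (p * p) = 0 -> p = 0.
Proof.
move=> cd pp0; pose F := antideriv (p * p).
have F0 : F - (F.[c])%:P = 0.
  apply: (poly_eq0_on_itv cd) => x /andP[cx xd]; rewrite !hornerE.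
  have sq y : 0 <= (p * p).[y] by rewrite hornerM -expr2 sqr_ge0.
  have := pint_ge0 cx sq; have := pint_ge0 xd sq.
  by move: pp0; rewrite /pint -/F; lra.
have : (F - (F.[c])%:P)^`() = 0 by rewrite F0 deriv0.
rewrite derivB derivC subr0 deriv_antideriv => /eqP.
by rewrite mulf_eq0 orbb => /eqP.
Qed.

(** Here [p] is any polynomial primitive of an approximation of [g]. *)
Lemma primitive_approx f g c d p (E : R) : mu.-integrable `[c, d] (EFin \o g) ->
  (forall x, c <= x <= d -> f x = f c + \int[mu]_(t in `[c, x]) g t) ->
  (forall x, c <= x <= d -> `|g x - p^`().[x]| <= E) ->
  forall x, c <= x <= d -> `|f x - f c - (p.[x] - p.[c])| <= E * (x - c).
Proof.
move=> ig fg gE x /andP[cx xd].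
have igx : mu.-integrable `[c, x] (EFin \o g).
  by apply: integrableS ig => //; apply: subset_itvl; rewrite bnd_simp.
rewrite (fg x) ?cx // [f c + _]addrC addrK -pint_deriv -Rintegral_horner //.
rewrite -RintegralB //; last exact: integrable_horner.
apply: norm_Rintegral_le => //.
  by have := integrableB _ igx (integrable_horner c x p^`()); apply.
by move=> y /andP[cy yx]; apply: gE; rewrite cy (le_trans yx).
Qed.

(** Integrating an approximation of [f 1] gains a factor [d - c] and one degree,
    so induction on the number of derivatives avoids any remainder formula. *)
Lemma taylor_approx n (f : nat -> R -> R) c d (M : R) : c <= d ->
  (forall i, (i < n)%N -> mu.-integrable `[c, d] (EFin \o f i.+1)) ->
  (forall i, (i < n)%N -> forall x, c <= x <= d ->
    f i x = f i c + \int[mu]_(t in `[c, x]) f i.+1 t) ->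
  (forall x, c <= x <= d -> `|f n x| <= M) ->
  exists2 T : {poly R}, (size T <= n)%N &
    forall x, c <= x <= d -> `|f 0%N x - T.[x]| <= M * (d - c) ^+ n.
Proof.
move=> cd; elim: n f => [|n IH] f If fE fM.
  by exists 0; rewrite ?size_poly0 // => x ?; rewrite horner0 subr0 mulr1 fM.
have [|||T sT TM] := IH (fun i => f i.+1) => //.
- by move=> i ?; exact: If.
- by move=> i ?; exact: fE.
exists (antideriv T + (f 0%N c - (antideriv T).[c])%:P).
  rewrite (leq_trans (size_polyD _ _)) // geq_max.
  rewrite (leq_trans (size_antideriv_leq _)) ?ltnS //.
  by rewrite (leq_trans (size_polyC_leq1 _)).
move=> x cxd.
have := primitive_approx (If 0%N isT) (fE 0%N isT) (p := antideriv T).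
rewrite deriv_antideriv => /(_ _ TM x cxd) H.
rewrite hornerD hornerC [X in `|X|](_ : _ =
  f 0%N x - f 0%N c - ((antideriv T).[x] - (antideriv T).[c])); last by ring.
apply: le_trans H _; rewrite exprSr mulrA ler_wpM2l //; last first.
  by case/andP: cxd => _ ?; rewrite lerD2r.
by apply: le_trans (TM x cxd).
Qed.

End Analysis.

(** * Legendre polynomials and L2 projection on one cell *)

Section LocalProjection.
Context {R : realType} (k : nat).
Local Notation mu := (@lebesgue_measure R).

(** These polynomials represent the coefficient functionals.  They give the L2
    projection of [g] as a sum of moments of [g] times fixed polynomials, and the
    last one, orthogonal to all lower degrees, is a Legendre polynomial. *)
Lemma pint_dual_basis : exists2 f : 'I_k.+1 -> {poly R},
  forall l, (size (f l) <= k.+1)%N &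
  forall l (v : {poly R}), (size v <= k.+1)%N -> pint 0 1 (f l * v) = v`_l.
Proof.
pose V := {poly_k.+1 R}.
pose B (u v : V) : R := pint 0 1 ((u : {poly R}) * (v : {poly R})).
have dual (l : 'I_k.+1) : exists u : V, forall v : V, B u v = (v : {poly R})`_l.
  apply: riesz_exists.
  - by move=> v a x y; rewrite /B linearP /= mulrDl -scalerAl linearP.
  - by move=> v a x y; rewrite /B linearP /= mulrDr -scalerAr linearP.
  - by move=> a x y; rewrite linearP /= coefD coefZ.
  - by move=> u /(pint_sqr_eq0 ltr01) u0; apply/val_inj.
have [f fP] := fin_all_exists dual.
exists (fun l => f l : {poly R}) => [l|l v sv]; first exact: size_npoly.
by have := fP l (npolyp _ v); rewrite /B npolypK.
Qed.

Lemma to_ref_itv (c d x : R) : c < d -> c <= x <= d -> 0 <= (to_ref c d).[x] <= 1.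
Proof.
move=> cd /andP[cx xd]; rewrite /to_ref !hornerE mulrC.
by rewrite divr_ge0 ?subr_ge0 ?(ltW cd) //= ler_pdivrMr ?subr_gt0 // mul1r lerD2r.
Qed.

(** Let [F], of degree [k], be orthogonal to lower degrees on [[0, 1]].  Integrating
    [(F^2)' = 2 F F'] gives [F(0)^2 = F(1)^2], and integrating [(x F^2)'] gives
    [F(1)^2 = (2 k + 1) \int F^2], which is nonzero; so [F] can be normalized to be
    [1] at the right end. *)
Lemma legendre_local : exists2 s : R, `|s| = 1 & exists2 C : R, 0 <= C &
  forall c d : R, c < d -> exists L : {poly R},
  [/\ (size L <= k.+1)%N, L.[d] = 1, L.[c] = s,
      forall v : {poly R}, (size v <= k)%N -> pint c d (L * v) = 0 &
      forall x, c <= x <= d -> `|L.[x]| <= C].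
Proof.
have [f sf fP] := pint_dual_basis.
pose F := f ord_max; pose I := pint 0 1 (F * F).
have F_orth (v : {poly R}) : (size v <= k)%N -> pint 0 1 (F * v) = 0.
  by move=> sv; rewrite fP /= ?nth_default // ltnW.
have sF : (size F <= k.+1)%N by exact: sf.
have sF' : (size F^`() <= k)%N.
  have [->|F0] := eqVneq F 0; first by rewrite deriv0 size_poly0.
  by rewrite -ltnS (leq_trans (lt_size_deriv F0)).
have I0 : I != 0.
  apply/eqP => /(pint_sqr_eq0 ltr01) F0.
  have := fP ord_max 'X^k; rewrite size_polyXn -/F F0 mul0r linear0 coefXn eqxx.
  by move=> /(_ (leqnn _))/esym/eqP; rewrite oner_eq0.
have F01 : F.[0] ^+ 2 = F.[1] ^+ 2.
  have := pint_by_parts 0 1 F F; rewrite [F^`() * F]mulrC F_orth // !expr2.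
  by lra.
have F1 : F.[1] ^+ 2 = (2 * k + 1)%:R * I.
  have := pint_by_parts 0 1 'X (F * F).
  rewrite derivX mul1r -/I !hornerX mul1r mul0r subr0 !hornerM -expr2.
  have -> : 'X * (F * F)^`() = 2%:R *: (F * ('X * F^`())).
    rewrite derivM scaler_nat; ring.
  rewrite linearZ /= fP; last first.
    by rewrite mulrC (leq_trans (size_polyMleq _ _)) // size_polyX addn2 ltnS.
  rewrite coefXM; have IE : I = F`_k by rewrite /I fP.
  case: (k) IE => [|m] IE /=; first by rewrite mulr0 subr0 muln0 add0n mul1r => ->.
  rewrite coef_deriv -IE -[I *+ _]mulr_natl natrD natrM; lra.
have F1n0 : F.[1] != 0.
  by rewrite -sqrf_eq0 F1 mulf_neq0 // pnatr_eq0 addn1.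
exists (F.[0] / F.[1]).
  apply/eqP; rewrite -sqrp_eq1 // -normrX exprMn F01 -exprMn divff // expr1n.
  by rewrite normr1.
exists (\sum_(i < size F) `|F`_i| / `|F.[1]|); first by rewrite sumr_ge0.
move=> c d cd; exists ((F.[1])^-1 *: (F \Po to_ref c d)).
have ref_c : (to_ref c d).[c] = 0 by rewrite /to_ref !hornerE subrr mulr0.
have ref_d : (to_ref c d).[d] = 1.
  by rewrite /to_ref !hornerE mulVf // subr_eq0 gt_eqF.
split.
- by rewrite (leq_trans (size_scale_leq _ _)) // size_to_ref.
- by rewrite hornerZ horner_comp ref_d mulVf.
- by rewrite hornerZ horner_comp ref_c mulrC.
- move=> v sv; rewrite -scalerAl linearZ /=.
  rewrite -[v]comp_polyXr -(of_ref_to_ref cd) comp_polyA -comp_polyM.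
  by rewrite pint_to_ref // F_orth ?size_of_ref // !mulr0.
- move=> x cxd; rewrite hornerZ horner_comp normrM normfV mulrC -mulr_suml.
  rewrite ler_wpM2r ?invr_ge0 // norm_horner_le_coefs //.
  exact: to_ref_itv.
Qed.

(** The moments of [g] are bounded by [M], and the dual basis is fixed on the
    reference cell. *)
Lemma projection_local : exists2 C : R, 0 <= C &
  forall (c d : R) (g : R -> R) (M : R), c < d -> measurable_fun `[c, d] g ->
  (forall x, c <= x <= d -> `|g x| <= M) ->
  exists Q : {poly R}, [/\ (size Q <= k.+1)%N,
    forall v : {poly R}, (size v <= k.+1)%N ->
      \int[mu]_(x in `[c, d]) (g x * v.[x]) = pint c d (Q * v) &
    forall x, c <= x <= d -> `|Q.[x]| <= C * M].
Proof.
have [f sf fP] := pint_dual_basis.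
exists (\sum_l \sum_(i < size (f l)) `|(f l)`_i|).
  by apply: sumr_ge0 => l _; exact: sumr_ge0.
move=> c d g M cd mg gM.
have dc0 : d - c != 0 by rewrite subr_eq0 gt_eqF.
have bg : bounded_measurable `[c, d] g.
  by split => //; exists M => x /=; rewrite in_itv /=; exact: gM.
have bgp p : mu.-integrable `[c, d] (EFin \o (fun x => g x * p.[x])).
  apply/bounded_measurable_integrable/bounded_measurableM => //.
  exact: bounded_measurable_horner.
pose m (l : 'I_k.+1) :=
  (d - c)^-1 * \int[mu]_(x in `[c, d]) (g x * ((to_ref c d) ^+ l).[x]).
have mM l : `|m l| <= M.
  rewrite /m normrM ger0_norm; last by rewrite invr_ge0 subr_ge0 ltW.
  rewrite mulrC ler_pdivrMr ?subr_gt0 //; apply: norm_Rintegral_le => //.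
    exact: ltW.
  move=> x cxd; have /andP[x0 x1] := to_ref_itv cd cxd.
  rewrite normrM -[M]mulr1 ler_pM ?gM // horner_exp normrX ger0_norm //.
  exact: exprn_ile1.
exists (\sum_l m l *: (f l \Po to_ref c d)); split.
- apply: (leq_trans (size_sum _ _ _)); apply/bigmax_leqP => l _.
  by rewrite (leq_trans (size_scale_leq _ _)) // size_to_ref.
- move=> v sv.
  have vE : v = (v \Po of_ref c d) \Po to_ref c d.
    by rewrite -comp_polyA of_ref_to_ref // comp_polyXr.
  set w := v \Po _ in vE; have sw : (size w <= k.+1)%N by rewrite size_of_ref.
  have -> : pint c d ((\sum_l m l *: (f l \Po to_ref c d)) * v) =
            \sum_l m l * ((d - c) * w`_l).
    rewrite mulr_suml linear_sum; apply: eq_bigr => l _ /=.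
    by rewrite -scalerAl linearZ /= vE -comp_polyM pint_to_ref // fP.
  have -> : (fun x => g x * v.[x]) =
      (fun x => \sum_(l < k.+1) w`_l * (g x * ((to_ref c d) ^+ l).[x])).
    apply/funext => x; rewrite {1}vE horner_comp (horner_coef_wide _ sw) mulr_sumr.
    by apply: eq_bigr => l _; rewrite horner_exp; ring.
  have sumE (n : nat) (h : 'I_n -> R -> R) :
      (forall l, bounded_measurable `[c, d] (h l)) ->
      \int[mu]_(x in `[c, d]) (\sum_l h l x) = \sum_l \int[mu]_(x in `[c, d]) h l x.
    elim: n h => [|n IH] h bh.
      under eq_Rintegral do rewrite big_ord0.
      by rewrite big_ord0 Rintegral_cst // mul0r.
    under eq_Rintegral do rewrite big_ord_recl.
    rewrite RintegralD //; last 2 first.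
      exact: bounded_measurable_integrable.
      apply/bounded_measurable_integrable/bounded_measurable_sum => l; exact: bh.
    by rewrite IH ?big_ord_recl // => l; exact: bh.
  rewrite sumE; last first.
    move=> l; apply/bounded_measurableM; first exact: bounded_measurable_cst.
    by apply/bounded_measurableM => //; exact: bounded_measurable_horner.
  by apply: eq_bigr => l _; rewrite RintegralZl // /m; field.
- move=> x cxd; rewrite horner_sum (le_trans (ler_norm_sum _ _ _)) //.
  rewrite mulr_suml; apply: ler_sum => l _.
  rewrite hornerZ normrM mulrC ler_pM // horner_comp norm_horner_le_coefs //.
  exact: to_ref_itv.
Qed.

End LocalProjection.

(** * Generalized Gauss-Radau projection *)

Section GaussRadau.
Context {R : realType} (k : nat).

Lemma norm_half_neq (theta s : R) : theta <> 2^-1 -> `|s| = 1 ->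
  `|theta| != `|(1 - theta) * s|.
Proof.
move=> th s1; rewrite normrM s1 mulr1; apply/eqP => /eqP.
by rewrite eqr_norm2 => /orP[] /eqP; lra.
Qed.

(** The cellwise L2 projection [Q] already has the right moments; they are not
    affected by adding multiples [c_i] of the local Legendre polynomials, whose
    end values [1] and [s] turn the flux conditions into a cyclic system for [c]. *)
Lemma gauss_radau (theta : R) : theta <> 2^-1 -> exists2 C : R, 0 <= C &
  forall (N : nat) (xs : nat -> R) (Y : 'I_N -> {poly R}) (r : 'I_N -> R) (M : R),
  (forall i : 'I_N, xs i < xs i.+1) ->
  (forall (i : 'I_N) x, xs i <= x <= xs i.+1 -> `|(Y i).[x]| <= M) ->
  (forall i, `|r i| <= M) ->
  exists p : Vh R k N,
  [/\ forall (i : 'I_N) (v : {poly R}), (size v <= k)%N ->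
        pint (xs i) (xs i.+1) ((p i : {poly R}) * v) = pint (xs i) (xs i.+1) (Y i * v),
      forall i, flux xs theta p i = r i &
      forall (i : 'I_N) x, xs i <= x <= xs i.+1 -> `|(p i : {poly R}).[x]| <= C * M].
Proof.
move=> th; have [s s1 [C1 C1_0 leg]] := @legendre_local R k.
have [C2 C2_0 proj] := @projection_local R k.
have neq := norm_half_neq th s1.
pose D : R := `| `|theta| - `|(1 - theta) * s| |.
pose K : R := (1 + (`|theta| + `|1 - theta|) * C2) / D.
have D0 : 0 <= D by rewrite normr_ge0.
have K0 : 0 <= K by rewrite divr_ge0 // addr_ge0 // mulr_ge0 // addr_ge0.
exists (C2 + K * C1); first by rewrite addr_ge0 // mulr_ge0.
move=> N xs Y r M lt_xs YM rM.
have /fin_all_exists[Q QP] (i : 'I_N) : exists Q : {poly R}, [/\ (size Q <= k.+1)%N,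
    forall v : {poly R}, (size v <= k.+1)%N ->
      pint (xs i) (xs i.+1) (Y i * v) = pint (xs i) (xs i.+1) (Q * v) &
    forall x, xs i <= x <= xs i.+1 -> `|Q.[x]| <= C2 * M].
  have [|Q [sQ Qv QM]] := proj _ _ _ M (lt_xs i) _ (YM i).
    by have [] := @bounded_measurable_horner _ (xs i) (xs i.+1) (Y i).
  exists Q; split => // v sv; rewrite -Qv // -Rintegral_horner ?ltW //.
  by under eq_Rintegral do rewrite hornerM.
have /fin_all_exists[L LP] (i : 'I_N) := leg _ _ (lt_xs i).
pose q : Vh R k N := [ffun i => npolyp k.+1 (Q i)].
have qE i : (q i : {poly R}) = Q i by rewrite ffunE npolypK //; case: (QP i).
have QM (i : 'I_N) x : xs i <= x <= xs i.+1 -> `|(Q i).[x]| <= C2 * M.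
  by case: (QP i) => _ _; apply.
have [c cP] := circulant_solvable neq (fun i => r i - flux xs theta q i).
have cM i : `|c i| <= K * M.
  have := circulant_bound neq cP (M := (1 + (`|theta| + `|1 - theta|) * C2) * M) _ i.
  rewrite /K mulrAC; apply=> {}i.
  rewrite (le_trans (ler_normB _ _)) // mulrDl mul1r lerD // mulrDl mulrDl.
  rewrite (le_trans (ler_normD _ _)) // !normrM -!mulrA.
  rewrite lerD // ler_wpM2l // /left_lim /right_lim qE QM // ?lexx ltW //.
pose p : Vh R k N := [ffun i => npolyp k.+1 (Q i + c i *: L i)].
have pE i : (p i : {poly R}) = Q i + c i *: L i.
  rewrite ffunE npolypK // (leq_trans (size_polyD _ _)) // geq_max.
  by case: (QP i) (LP i) => -> _ _ [sL _ _ _ _]; rewrite (leq_trans (size_scale_leq _ _)).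
exists p; split.
- move=> i v sv; have [_ Qv _] := QP i; rewrite Qv; last exact: leqW.
  by have [_ _ _ Lv _] := LP i; rewrite pE mulrDl linearD -scalerAl linearZ /= Lv //
    mulr0 addr0.
- move=> i.
  have -> : r i = flux xs theta q i + (theta * c i + (1 - theta) * s * c (ordS i)).
    by rewrite cP; ring.
  rewrite /flux /left_lim /right_lim !pE !qE !(hornerD, hornerZ).
  by case: (LP i) (LP (ordS i)) => _ -> _ _ _ [_ _ -> _ _]; ring.
- move=> i x xi; rewrite pE hornerD hornerZ (le_trans (ler_normD _ _)) // mulrDl.
  rewrite lerD ?QM // normrM mulrAC ler_pM ?cM //.
  by case: (LP i) => _ _ _ _; apply.
Qed.

End GaussRadau.

(** * Integration over a mesh *)

Section Mesh.
Context {R : realType} (a b : R) (N : nat) (xs : nat -> R).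
Hypothesis hmesh : is_mesh a b N xs.
Local Notation mu := (@lebesgue_measure R).

Lemma mesh_lt (i : 'I_N) : xs i < xs i.+1.
Proof. by have [_ _] := hmesh; apply; exact: ltn_ord. Qed.

Lemma mesh_le i j : (i <= j <= N)%N -> xs i <= xs j.
Proof.
move=> /andP[ij jN]; elim: j ij jN => [|j IH].
  by rewrite leqn0 => /eqP ->.
rewrite leq_eqVlt => /predU1P[-> //|ij jN]; apply: le_trans (IH ij (ltnW jN)) _.
exact: ltW (mesh_lt (Ordinal jN)).
Qed.

Lemma cell_sub (i : 'I_N) x : xs i <= x <= xs i.+1 -> a <= x <= b.
Proof.
have [<- <- _] := hmesh; move=> /andP[ix xi].
by rewrite (le_trans _ ix) ?(le_trans xi) // mesh_le ?leqnn ?ltn_ord //= ltnW.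
Qed.

Lemma mesh_size_ge (i : 'I_N) : xs i.+1 - xs i <= mesh_size N xs.
Proof. exact: (le_bigmax _ (fun i : 'I_N => xs i.+1 - xs i) i). Qed.

Lemma mesh_size_ge0 : 0 <= mesh_size N xs.
Proof. exact: bigmax_ge_id. Qed.

Lemma mesh_cell x : a <= x < b -> exists i : 'I_N, xs i <= x < xs i.+1.
Proof.
have [xa xb _] := hmesh; rewrite -xa -xb => /andP[ax].
suff main n : (n <= N)%N -> x < xs n -> exists i : 'I_N, xs i <= x < xs i.+1 by exact: main.
elim: n => [|n IH] nN xn; first by move: (le_lt_trans ax xn); rewrite ltxx.
have [le|lt] := leP (xs n) x; last exact: IH (ltnW nN) lt.
by exists (Ordinal nN); rewrite /= le xn.
Qed.

Lemma mesh_nonempty : a < b -> (0 < N)%N.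
Proof.
move=> ab; have [|i _] := @mesh_cell a; first by rewrite lexx.
by apply: leq_trans (ltn_ord i).
Qed.

Lemma pw_cell (p : 'I_N -> {poly R}) (i : 'I_N) x :
  xs i <= x < xs i.+1 -> pw xs p x = (p i).[x].
Proof.
move=> /andP[ix xi]; rewrite /pw (bigD1 i) //= big1 ?addr0.
  by rewrite indicE mem_set ?mul1r //= in_itv /= ix.
move=> j ji; rewrite indicE memNset ?mul0r //= in_itv /=.
move=> /andP[jx xj]; move: ji; rewrite -val_eqE /= neq_ltn => /orP[ji|ij].
  have /(_ _)/(lt_le_trans xj) := @mesh_le j.+1 i.
  by rewrite ji (ltnW (ltn_ord i)) => /(_ isT); rewrite ltNge ix.
have /(_ _)/(lt_le_trans xi) := @mesh_le i.+1 j.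
by rewrite ij (ltnW (ltn_ord j)) => /(_ isT); rewrite ltNge jx.
Qed.

Lemma bounded_measurable_pw (p : 'I_N -> {poly R}) :
  bounded_measurable `[a, b] (pw xs p).
Proof.
apply: bounded_measurable_sum => i; apply: bounded_measurableM.
  split; first exact/measurable_funTS/measurable_indic.
  by exists 1 => x _; rewrite indicE; case: (_ \in _); rewrite ?normr1 ?normr0.
exact: bounded_measurable_horner.
Qed.

Lemma subset_cell (i : 'I_N) : `[xs i, xs i.+1] `<=` `[a, b].
Proof. by move=> x /=; rewrite !in_itv /=; exact: cell_sub. Qed.

Lemma Rintegral_mesh g : mu.-integrable `[a, b] (EFin \o g) ->
  \int[mu]_(x in `[a, b]) g x = \sum_(i < N) \int[mu]_(x in `[xs i, xs i.+1]) g x.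
Proof.
have [xa xb _] := hmesh => ig.
suff main n : (n <= N)%N -> \int[mu]_(x in `[a, xs n]) g x =
    \sum_(0 <= i < n) \int[mu]_(x in `[xs i, xs i.+1]) g x.
  by rewrite -xb main // big_mkord.
elim: n => [|n IH] nN; first by rewrite big_geq // xa set_itv1 Rintegral_set1.
have an : a <= xs n by rewrite -xa mesh_le //= ltnW.
have nS : xs n <= xs n.+1 by rewrite mesh_le // leqnSn.
have igS c d : a <= c -> d <= b -> mu.-integrable `[c, d] (EFin \o g).
  by move=> ac db; apply: integrableS ig => //; apply: subset_itv; rewrite bnd_simp.
have Sb : xs n.+1 <= b by rewrite -xb mesh_le ?nN ?leqnn.
rewrite big_nat_recr; last by [].
rewrite -(IH (ltnW nN)).
have igS1 := igS _ _ (lexx a) Sb.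
have := Rintegral_itvB igS1 (x := xs n); rewrite !bnd_simp => /(_ an nS)/eqP.
rewrite subr_eq addrC => /eqP ->; congr (_ + _); apply: Rintegral_itv_obnd_cbnd.
by apply: integrableS (igS _ _ an Sb) => //; apply: subset_itv; rewrite bnd_simp.
Qed.

Lemma inner_pw g (p : 'I_N -> {poly R}) : bounded_measurable `[a, b] g ->
  inner a b g (pw xs p) =
  \sum_(i < N) \int[mu]_(x in `[xs i, xs i.+1]) (g x * (p i).[x]).
Proof.
move=> bg; have bgp := bounded_measurableM bg (bounded_measurable_pw p).
rewrite /inner Rintegral_mesh; last exact: bounded_measurable_integrable.
apply: eq_bigr => i _.
have co f : bounded_measurable `[xs i, xs i.+1] f ->
    \int[mu]_(x in `[xs i, xs i.+1[) f x = \int[mu]_(x in `[xs i, xs i.+1]) f x.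
  move=> bf; apply: Rintegral_itv_bndo_bndc.
  apply: integrableS (bounded_measurable_integrable bf) => //.
  by apply: subset_itvl; rewrite bnd_simp.
have bgi f : bounded_measurable `[a, b] f -> bounded_measurable `[xs i, xs i.+1] f.
  by move=> bf; apply: bounded_measurableS bf => //; exact: subset_cell.
rewrite -(co _ (bgi _ bgp)) -(co (fun x => g x * (p i).[x])); last first.
  by apply: bounded_measurableM (bgi _ bg) _; exact: bounded_measurable_horner.
by apply: eq_Rintegral => x; rewrite inE /= in_itv /= => xi; rewrite (pw_cell _ xi).
Qed.

Lemma inner_pw_pw (p q : 'I_N -> {poly R}) :
  inner a b (pw xs p) (pw xs q) = \sum_(i < N) pint (xs i) (xs i.+1) (p i * q i).
Proof.
rewrite inner_pw; last exact: bounded_measurable_pw.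
apply: eq_bigr => i _; rewrite -Rintegral_horner ?ltW ?mesh_lt //.
rewrite -!Rintegral_itv_bndo_bndc.
- apply: eq_Rintegral => x; rewrite inE /= in_itv /= => xi.
  by rewrite (pw_cell _ xi) hornerM.
- apply: integrableS (integrable_horner (xs i) (xs i.+1) (p i * q i)) => //.
  by apply: subset_itvl; rewrite bnd_simp.
- have : bounded_measurable `[xs i, xs i.+1] (fun x => pw xs p x * (q i).[x]).
    apply: bounded_measurableM; last exact: bounded_measurable_horner.
    by apply: bounded_measurableS (bounded_measurable_pw p) => //; exact: subset_cell.
  move=> /bounded_measurable_integrable; apply: integrableS => //.
  by apply: subset_itvl; rewrite bnd_simp.
Qed.

End Mesh.

(** * The discontinuous Galerkin derivative and its inverse *)

Section DGOperators.
Context {R : realType} (a b : R) (k N : nat) (xs : nat -> R).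
Hypothesis hmesh : is_mesh a b N xs.
Local Notation mu := (@lebesgue_measure R).
Local Notation V := (Vh R k N) (only parsing).
Local Notation cint i p := (pint (xs i) (xs i.+1) p).
Local Notation lt_xs := (mesh_lt hmesh).

Definition vh_inner (u v : V) : R :=
  \sum_(i < N) cint i ((u i : {poly R}) * (v i : {poly R})).

(** The right-hand side of the weak formulation defining [Dh theta w]. *)
Definition dgform (theta : R) (w v : V) : R :=
  - \sum_(i < N) cint i ((w i : {poly R}) * (v i : {poly R})^`())
  - \sum_(i < N) flux xs theta w i * jump xs v i.

Lemma inner_vfun (u v : V) : inner a b (vfun xs u) (vfun xs v) = vh_inner u v.
Proof. exact: inner_pw_pw. Qed.

Lemma DhE theta (w : V) : Dh a b xs theta w = riesz a b xs (dgform theta w).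
Proof.
by congr riesz; apply/funext => v; rewrite /dgform /vfun /dvfun inner_pw_pw.
Qed.

Lemma ffun_linE (c : R) (u v : V) (i : 'I_N) :
  ((c *: u + v) i : {poly R}) = c *: (u i : {poly R}) + (v i : {poly R}).
Proof. by rewrite !ffunE linearP. Qed.

Lemma vh_inner_sym u v : vh_inner u v = vh_inner v u.
Proof. by apply: eq_bigr => i _; rewrite mulrC. Qed.

Lemma vh_inner_linear u : scalar (vh_inner u).
Proof.
move=> c v w; rewrite /vh_inner mulr_sumr -big_split; apply: eq_bigr => i _ /=.
by rewrite ffun_linE mulrDr -scalerAr linearP.
Qed.

Lemma dgform_linear theta w : scalar (dgform theta w).
Proof.
move=> c u v; rewrite /dgform.
under eq_bigr do rewrite ffun_linE derivD derivZ mulrDr -scalerAr linearP.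
under [X in _ - X]eq_bigr => i _.
  rewrite [X in _ * X](_ : _ = c * jump xs u i + jump xs v i); last first.
    by rewrite /jump /left_lim /right_lim !ffun_linE !(hornerD, hornerZ); ring.
  rewrite mulrDr mulrCA; over.
by rewrite big_split [X in _ - X]big_split /= -!mulr_sumr; ring.
Qed.

Lemma vh_inner_eq0 u : vh_inner u u = 0 -> u = 0.
Proof.
have ge0 (i : 'I_N) : 0 <= cint i ((u i : {poly R}) * (u i : {poly R})).
  by apply: pint_ge0 => [|x]; [exact/ltW/lt_xs | rewrite hornerM -expr2 sqr_ge0].
move/eqP; rewrite psumr_eq0 // => /allP u0; apply/ffunP => i; apply/val_inj.
rewrite ffunE; apply: pint_sqr_eq0 (lt_xs i) _.
by apply/eqP/(u0 i); rewrite mem_index_enum.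
Qed.

Lemma vh_inner_inj u v : (forall t, vh_inner u t = vh_inner v t) -> u = v.
Proof.
move=> uv; apply/eqP; rewrite -subr_eq0; apply/eqP/vh_inner_eq0.
have lin x : vh_inner x (u - v) = vh_inner x u - vh_inner x v.
  by rewrite addrC -scaleN1r vh_inner_linear mulN1r addrC.
by rewrite lin [vh_inner _ u]vh_inner_sym [vh_inner _ v]vh_inner_sym uv subrr.
Qed.

Lemma riesz_eq (L : V -> R) u : (forall v, vh_inner u v = L v) -> riesz a b xs L = u.
Proof.
move=> uL; apply: xget_unique => [v|u' u'L]; first by rewrite inner_vfun.
by apply: vh_inner_inj => v; rewrite uL -inner_vfun u'L.
Qed.

Lemma rieszP (L : V -> R) : scalar L -> forall v, vh_inner (riesz a b xs L) v = L v.
Proof.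
move=> linL v; rewrite -inner_vfun; move: v.
apply: (@xgetPex _ 0 [set u : V | forall v, inner a b (vfun xs u) (vfun xs v) = L v]).
have [|u uL] := @riesz_exists _ V vh_inner L _ vh_inner_linear linL vh_inner_eq0.
  by move=> v c x y; rewrite vh_inner_sym vh_inner_linear !(vh_inner_sym v).
by exists u => v; rewrite inner_vfun uL.
Qed.

Lemma sum_ordS (F : 'I_N -> R) : \sum_(i < N) F (ordS i) = \sum_(i < N) F i.
Proof. by rewrite [RHS](reindex_inj (@ordS_inj N)). Qed.

(** The adjoint of [D_theta] is [- D_(1 - theta)]: integrate by parts on each cell
    and regroup the boundary terms by interface. *)
Lemma dgform_skew theta w v : dgform theta w v = - dgform (1 - theta) v w.
Proof.
have by_parts : \sum_(i < N) cint i ((v i : {poly R}) * (w i : {poly R})^`()) =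
    \sum_(i < N) (left_lim xs w i * left_lim xs v i
      - right_lim xs w i * right_lim xs v i)
    - \sum_(i < N) cint i ((w i : {poly R}) * (v i : {poly R})^`()).
  rewrite [X in _ = X - _]sumrB.
  have -> : \sum_(i < N) right_lim xs w i * right_lim xs v i =
      \sum_(i < N) (w i : {poly R}).[xs i] * (v i : {poly R}).[xs i].
    exact: (sum_ordS (fun i => (w i : {poly R}).[xs i] * (v i : {poly R}).[xs i])).
  rewrite -!sumrB; apply: eq_bigr => i _ /=.
  by rewrite mulrC pint_by_parts.
rewrite /dgform by_parts opprD !opprK -addrA addrC -!addrA; congr (_ + _).
rewrite -sumrN -big_split /=; apply: eq_bigr => i _; rewrite /flux /jump; ring.
Qed.

Lemma ZhE (z : V) : Zh a b xs z <-> \sum_(i < N) cint i (z i : {poly R}) = 0.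
Proof.
rewrite /Zh /= [X in X = 0](_ : _ = inner a b (cst 1) (vfun xs z)); last first.
  by apply: eq_Rintegral => x _; rewrite mulrC.
rewrite (inner_pw hmesh) //; last exact: bounded_measurable_cst.
rewrite (eq_bigr (fun i : 'I_N => cint i (z i : {poly R}))) // => i _.
rewrite -Rintegral_horner ?ltW ?lt_xs //.
by apply: eq_Rintegral => x _; rewrite mul1r.
Qed.

Definition node_integral (z : V) n : R :=
  \sum_(j < N | (j < n)%N) cint j (z j : {poly R}).

Lemma node_integralS (z : V) (i : 'I_N) :
  node_integral z i.+1 = node_integral z i + cint i (z i : {poly R}).
Proof.
rewrite /node_integral (bigD1 i) ?ltnSn //= addrC; congr (_ + _); apply: eq_bigl => j.
by rewrite ltnS -val_eqE /= [RHS]ltn_neqAle andbC.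
Qed.

Lemma node_integral0 (z : V) : node_integral z 0 = 0.
Proof. by rewrite /node_integral big_pred0. Qed.

Lemma node_integralN (z : V) : Zh a b xs z -> node_integral z N = 0.
Proof. by move/ZhE => <-; apply: eq_bigl => j; rewrite ltn_ord. Qed.

(** The constants are chosen so that the pieces fit together continuously,
    starting from zero at the left end of the domain. *)
Definition primitive (z : V) (i : 'I_N) : {poly R} :=
  antideriv (z i) + (node_integral z i - (antideriv (z i)).[xs i])%:P.

Lemma deriv_primitive (z : V) (i : 'I_N) : (primitive z i)^`() = z i.
Proof. by rewrite derivD derivC addr0 deriv_antideriv. Qed.

Lemma primitive_left (z : V) (i : 'I_N) : (primitive z i).[xs i] = node_integral z i.
Proof. by rewrite hornerD hornerC addrC subrK. Qed.

Lemma primitive_right (z : V) (i : 'I_N) :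
  (primitive z i).[xs i.+1] = node_integral z i.+1.
Proof. by rewrite node_integralS hornerD hornerC /pint; ring. Qed.

(** Zero mean is what closes the primitive up across the periodic boundary. *)
Lemma primitive_periodic (z : V) (i : 'I_N) : Zh a b xs z ->
  (primitive z i).[xs i.+1] = (primitive z (ordS i)).[xs (ordS i)].
Proof.
move=> Zz; rewrite primitive_left primitive_right /=.
have [lt|ge] := ltnP i.+1 N; first by rewrite modn_small.
have iN : i.+1 = N by apply/eqP; rewrite eqn_leq ltn_ord ge.
by rewrite iN modnn node_integral0 node_integralN.
Qed.

(** The test function enters the volume terms only through its derivative, so
    orthogonality to degrees less than [k] allows [u] to be replaced by [Y];
    integrating by parts then leaves [z = Y']. *)
Lemma dgform_of_primitive theta (u z : V) (Y : 'I_N -> {poly R}) :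
  (forall i : 'I_N, (Y i)^`() = z i) ->
  (forall i : 'I_N, (Y i).[xs i.+1] = (Y (ordS i)).[xs (ordS i)]) ->
  (forall i, flux xs theta u i = (Y i).[xs i.+1]) ->
  (forall (i : 'I_N) (v : {poly R}), (size v <= k)%N ->
    cint i ((u i : {poly R}) * v) = cint i (Y i * v)) ->
  forall v, dgform theta u v = vh_inner z v.
Proof.
move=> YE Yper fluxE orth v; rewrite /dgform /vh_inner.
have -> : \sum_(i < N) cint i ((u i : {poly R}) * (v i : {poly R})^`()) =
          \sum_(i < N) cint i (Y i * (v i : {poly R})^`()).
  apply: eq_bigr => i _; apply: orth; have := size_npoly (v i).
  have [->|v0 sv] := eqVneq (v i : {poly R}) 0; first by rewrite deriv0 size_poly0.
  by rewrite -ltnS (leq_trans (lt_size_deriv v0)).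
have -> : \sum_(i < N) flux xs theta u i * jump xs v i =
    \sum_(i < N) ((Y i).[xs i] * (v i : {poly R}).[xs i]
                  - (Y i).[xs i.+1] * (v i : {poly R}).[xs i.+1]).
  rewrite sumrB -(sum_ordS (fun i => (Y i).[xs i] * (v i : {poly R}).[xs i])).
  rewrite -sumrB; apply: eq_bigr => i _ /=.
  by rewrite fluxE /jump /left_lim /right_lim mulrBr -Yper.
rewrite -!sumrN -big_split; apply: eq_bigr => i _ /=.
by rewrite -YE pint_by_parts; ring.
Qed.

Lemma bounded_on_cells (Y : 'I_N -> {poly R}) : exists M : R,
  forall (i : 'I_N) x, xs i <= x <= xs i.+1 -> `|(Y i).[x]| <= M.
Proof.
have /fin_all_exists[M MP] (i : 'I_N) : exists M : R,
    forall x, xs i <= x <= xs i.+1 -> `|(Y i).[x]| <= M.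
  have [_ [M MP]] := @bounded_measurable_horner _ (xs i) (xs i.+1) (Y i).
  by exists M => x xi; apply: MP; rewrite /= in_itv.
exists (\sum_i `|M i|) => i x xi; rewrite (le_trans (MP i x xi)) //.
by rewrite (bigD1 i) //= (le_trans (ler_norm _)) // lerDl sumr_ge0.
Qed.

Lemma dgform_surj theta (z : V) : theta <> 2^-1 -> Zh a b xs z ->
  exists u : V, forall v, dgform theta u v = vh_inner z v.
Proof.
move=> th Zz; have [M MP] := bounded_on_cells (primitive z).
have [C _ radau] := gauss_radau k th.
have [|u [orth fl _]] :=
  radau N xs (primitive z) (fun i => (primitive z i).[xs i.+1]) M lt_xs MP.
  by move=> i; apply: MP; rewrite lexx ltW ?lt_xs.
exists u; apply: (dgform_of_primitive (Y := primitive z)) => // i.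
  exact: deriv_primitive.
exact: primitive_periodic.
Qed.

(** Uniqueness is by duality.  If [D_theta d = 0] with [d] of mean zero, choose [v]
    with [D_(1 - theta) v = d]; then
    [<d, d> = <D_(1 - theta) v, d> = - <D_theta d, v> = 0]. *)
Lemma Dinv_eq theta (u z : V) : theta <> 2^-1 -> Zh a b xs u ->
  (forall v, dgform theta u v = vh_inner z v) -> Dinv a b xs theta z = u.
Proof.
move=> th Zu uz; apply: xget_unique.
  by split=> //; rewrite DhE; apply: riesz_eq => v; rewrite uz.
move=> u' [Zu' u'z].
have {}u'z v : dgform theta u' v = vh_inner z v.
  by rewrite -u'z DhE rieszP //; exact: dgform_linear.
have Zd : Zh a b xs (u' - u).
  apply/ZhE; move/ZhE: Zu'; move/ZhE: Zu => Zu Zu'.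
  apply: etrans (subrr 0); rewrite -[X in _ = X - _]Zu' -[X in _ = _ - X]Zu -sumrB.
  apply: eq_bigr => i _.
  by rewrite !ffunE !linearB.
have th' : 1 - theta <> 2^-1 by lra.
have [v vd] := dgform_surj th' Zd.
apply/eqP; rewrite -subr_eq0; apply/eqP/vh_inner_eq0.
have lin x : vh_inner x (u' - u) = vh_inner x u' - vh_inner x u.
  by rewrite addrC -scaleN1r vh_inner_linear mulN1r addrC.
rewrite lin -!vd -[dgform _ v u']opprK -[dgform _ v u]opprK.
by rewrite -!(dgform_skew theta) u'z uz subrr.
Qed.

End DGOperators.

(** * Accuracy of one inverse operator *)

Section InverseStep.
Context {R : realType} (k : nat).
Local Notation mu := (@lebesgue_measure R).

Definition mean (a b : R) (w : R -> R) : R :=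
  inner a b w (cst 1) / inner a b (cst 1) (cst 1).

Lemma meanE a b (w : R -> R) : a < b ->
  mean a b w = (\int[mu]_(x in `[a, b]) w x) / (b - a).
Proof.
move=> ab; rewrite /mean /inner; congr (_ / _).
  by apply: eq_Rintegral => x _; rewrite mulr1.
under eq_Rintegral do rewrite mulr1.
by rewrite Rintegral_cst // itv_volume ?ltW // mul1r.
Qed.

(** The inverse operator turns the accuracy [E2] of a primitive of [z] into the
    same accuracy for the function itself, up to the error [E1] of any local
    polynomial approximation. *)
Lemma inverse_step (theta : R) : theta <> 2^-1 -> exists2 C : R, 0 <= C &
  forall (a b : R) (N : nat) (xs : nat -> R) (w : R -> R) (z : Vh R k N)
    (T : 'I_N -> {poly R}) (E1 E2 : R), a < b -> is_mesh a b N xs ->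
  mu.-integrable `[a, b] (EFin \o w) -> Zh a b xs z ->
  (forall i, (size (T i) <= k.+1)%N) ->
  (forall (i : 'I_N) x, xs i <= x <= xs i.+1 -> `|w x - w a - (T i).[x]| <= E1) ->
  (forall (i : 'I_N) x, xs i <= x <= xs i.+1 ->
     `|w x - w a - (primitive xs z i).[x]| <= E2) ->
  Zh a b xs (Dinv a b xs theta z) /\
  forall (i : 'I_N) x, xs i <= x <= xs i.+1 ->
    `|w x - mean a b w - (Dinv a b xs theta z i : {poly R}).[x]| <= C * (E1 + E2).
Proof.
move=> th; have [C0 C0_0 radau] := gauss_radau k th.
pose K : R := 1 + `|theta| + `|1 - theta|.
have K1 : 1 <= K by rewrite /K -addrA lerDl addr_ge0.
have K0 : 0 <= K by exact: le_trans K1.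
exists (2 * (1 + C0 * K)); first by rewrite mulr_ge0 // addr_ge0 // mulr_ge0.
move=> a b N xs w z T E1 E2 ab hm iw Zz sT TE ZE.
have lt_xs := mesh_lt hm.
have N0 := mesh_nonempty hm ab.
have lr (i : 'I_N) : (xs i <= xs i <= xs i.+1) /\ (xs i <= xs i.+1 <= xs i.+1).
  by rewrite !lexx ltW.
have E1_0 : 0 <= E1 by apply: le_trans (TE (Ordinal N0) _ (lr _).1).
have E2_0 : 0 <= E2 by apply: le_trans (ZE (Ordinal N0) _ (lr _).1).
pose M : R := E1 + E2.
have M0 : 0 <= M by rewrite addr_ge0.
have MKM : M <= K * M by rewrite ler_peMl.
(* Elements of the discrete space are reproduced, so only the small remainder
   needs to be projected. *)
pose Y (i : 'I_N) := primitive xs z i - T i.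
have YE (i : 'I_N) x : (Y i).[x] = (primitive xs z i).[x] - (T i).[x].
  by rewrite hornerD hornerN.
have YM (i : 'I_N) x : xs i <= x <= xs i.+1 -> `|(Y i).[x]| <= M.
  move=> xi; rewrite YE.
  rewrite (_ : _ - _ = (w x - w a - (T i).[x])
     - (w x - w a - (primitive xs z i).[x])); last by ring.
  by rewrite (le_trans (ler_normB _ _)) // lerD ?TE ?ZE.
pose r (i : 'I_N) := theta * (Y i).[xs i.+1] + (1 - theta) * (Y (ordS i)).[xs (ordS i)].
have rM i : `|r i| <= K * M.
  rewrite (le_trans (ler_normD _ _)) // !normrM /K !mulrDl.
  have h1 := ler_wpM2l (normr_ge0 theta) (YM i _ (lr i).2).
  have h2 := ler_wpM2l (normr_ge0 (1 - theta)) (YM (ordS i) _ (lr (ordS i)).1).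
  by lra.
have [|p [orth fl pM]] := radau N xs Y r (K * M) lt_xs _ rM.
  by move=> i x xi; rewrite (le_trans (YM i x xi)).
pose u0 i : {poly R} := T i + (p i : {poly R}).
(* The projection commutes with adding constants, so [u] below is still the
   projection of a primitive of [z]. *)
pose m := (\sum_(i < N) pint (xs i) (xs i.+1) (u0 i)) / (b - a).
pose u : Vh R k N := [ffun i => npolyp k.+1 (u0 i - m%:P)].
have uE i : (u i : {poly R}) = u0 i - m%:P.
  rewrite ffunE npolypK // (leq_trans (size_polyD _ _)) // geq_max size_polyN.
  rewrite (leq_trans (size_polyC_leq1 _)) // andbT.
  by rewrite (leq_trans (size_polyD _ _)) // geq_max sT size_npoly.
have sum_len : \sum_(i < N) (xs i.+1 - xs i) = b - a.
  have [xa xb _] := hm.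
  by rewrite -(big_mkord predT (fun i => xs i.+1 - xs i)) telescope_sumr // xa xb.
have ba0 : b - a != 0 by rewrite subr_eq0 gt_eqF.
have Zu : Zh a b xs u.
  apply/(ZhE hm).
  under eq_bigr do rewrite uE linearB /= pintC.
  by rewrite sumrB -mulr_sumr sum_len /m divfK // subrr.
have Du : Dinv a b xs theta z = u.
  apply: Dinv_eq => //.
  apply: (dgform_of_primitive (Y := fun i => primitive xs z i - m%:P)) => [i|i|i|i v sv].
  - by rewrite derivB derivC subr0 deriv_primitive.
  - by rewrite hornerD [RHS]hornerD !hornerN !hornerC (primitive_periodic hm i Zz).
  - have flE : flux xs theta u i = r i + theta * (T i).[xs i.+1]
        + (1 - theta) * (T (ordS i)).[xs (ordS i)] - m.
      by rewrite -fl /flux /left_lim /right_lim !uE /u0 !(hornerD, hornerN, hornerC); ring.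
    by rewrite flE /r hornerD hornerN hornerC !YE -(primitive_periodic hm i Zz); ring.
  - rewrite uE [_ * v](_ : _ = (T i - m%:P) * v + (p i : {poly R}) * v); last first.
      by rewrite /u0; ring.
    by rewrite linearD /= orth // -linearD /=; congr (pint _ _ _); rewrite /Y; ring.
pose E : R := (1 + C0 * K) * M.
have u0E (i : 'I_N) x : xs i <= x <= xs i.+1 -> `|w x - w a - (u0 i).[x]| <= E.
  move=> xi; rewrite /u0 hornerD opprD addrA (le_trans (ler_normB _ _)) //.
  rewrite /E mulrDl mul1r lerD //; last by rewrite -mulrA pM.
  by rewrite (le_trans (TE _ _ xi)) // lerDl.
have meanE' : `|mean a b w - w a - m| <= E.
  rewrite meanE // /m.
  have icst c : mu.-integrable `[a, b] (EFin \o (fun=> c : R)).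
    exact/bounded_measurable_integrable/bounded_measurable_cst.
  have -> : (\int[mu]_(x in `[a, b]) w x) / (b - a) - w a
      - (\sum_(i < N) pint (xs i) (xs i.+1) (u0 i)) / (b - a) =
     (\sum_(i < N) \int[mu]_(x in `[xs i, xs i.+1]) (w x - w a - (u0 i).[x])) / (b - a).
    rewrite -[w a in LHS](mulfK ba0) -!mulrBl; congr (_ / _).
    rewrite -(itv_volume (ltW ab)) -Rintegral_cst // -RintegralB //.
    rewrite (Rintegral_mesh hm); last by have := integrableB _ iw (icst (w a)); apply.
    rewrite -sumrB; apply: eq_bigr => i _.
    rewrite -Rintegral_horner ?ltW // -RintegralB //; last exact: integrable_horner.
    have iwa : mu.-integrable `[a, b] (EFin \o (fun x => w x - w a)).
      by have := integrableB _ iw (icst (w a)); apply.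
    by apply: integrableS iwa => //; exact: subset_cell.
  rewrite normrM normfV [`|b - a|]gtr0_norm ?subr_gt0 // ler_pdivrMr ?subr_gt0 //.
  rewrite (le_trans (ler_norm_sum _ _ _)) // -sum_len mulr_sumr; apply: ler_sum => i _.
  apply: norm_Rintegral_le => //; first exact/ltW/lt_xs; last exact: u0E.
  have iwa : mu.-integrable `[a, b] (EFin \o (fun x => w x - w a)).
    by have := integrableB _ iw (icst (w a)); apply.
  have iwi : mu.-integrable `[xs i, xs i.+1] (EFin \o (fun x => w x - w a)).
    by apply: integrableS iwa => //; exact: subset_cell.
  by have := integrableB _ iwi (integrable_horner (xs i) (xs i.+1) (u0 i)); apply.
rewrite Du; split => // i x xi; rewrite uE hornerD hornerN hornerC.
rewrite (_ : _ - _ = (w x - w a - (u0 i).[x]) - (mean a b w - w a - m)); last by ring.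
rewrite (le_trans (ler_normB _ _)) // -mulrA mulr2n mulrDl !mul1r.
by rewrite lerD // u0E.
Qed.

End InverseStep.

(** * Uniform bounds from the Sobolev norm *)

Section SobolevBounds.
Context {R : realType} (a b : R).
Hypothesis hab : a < b.
Local Notation mu := (@lebesgue_measure R).
Implicit Types f g : R -> R.

Lemma integrable_cst_itv (c d r : R) : mu.-integrable `[c, d] (EFin \o (fun=> r)).
Proof. exact/bounded_measurable_integrable/bounded_measurable_cst. Qed.

Lemma square_integrable_integrable f : square_integrable a b f ->
  mu.-integrable `[a, b] (EFin \o f).
Proof.
move=> [mf if2].
have i1 : mu.-integrable `[a, b] (EFin \o (fun x => 1 + f x ^+ 2)).
  by have := integrableD _ (integrable_cst_itv a b 1) if2; apply.
apply: le_integrable i1 => //; first exact/measurable_EFinP.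
move=> x _; rewrite /= lee_fin [`|1 + _|]ger0_norm ?addr_ge0 ?sqr_ge0 //.
have := sqr_ge0 (`|f x| - 1); have := sqr_ge0 (f x).
rewrite -(real_normK (num_real (f x))); nra.
Qed.

Lemma integrable_norm_itv f : mu.-integrable `[a, b] (EFin \o f) ->
  mu.-integrable `[a, b] (EFin \o (fun x => `|f x|)).
Proof. by move=> fi; have := integrable_norm fi; apply. Qed.

(** Integrate [`|f| <= t / 2 + f ^+ 2 / (2 * t)] and let [t] decrease to [S]. *)
Lemma l1norm_le_l2norm f S : square_integrable a b f -> l2norm a b f <= S ->
  \int[mu]_(x in `[a, b]) `|f x| <= (b - a + 1) / 2 * S.
Proof.
move=> fL2 fS; have [mf if2] := fL2.
have S0 : 0 <= S by apply: le_trans fS; exact: sqrtr_ge0.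
have ba0 : 0 < b - a by rewrite subr_gt0.
have inn0 : 0 <= inner a b f f by apply: Rintegral_ge0 => x _; rewrite -expr2 sqr_ge0.
have innS : inner a b f f <= S ^+ 2.
  by rewrite -(sqr_sqrtr inn0) ler_sqr ?nnegrE ?sqrtr_ge0.
have main t : 0 < t -> S <= t ->
    \int[mu]_(x in `[a, b]) `|f x| <= (b - a + 1) / 2 * t.
  move=> t0 St.
  have i2 : mu.-integrable `[a, b] (EFin \o (fun x => (2 * t)^-1 * f x ^+ 2)).
    by have := integrableZl _ (2 * t)^-1 if2; apply.
  have : \int[mu]_(x in `[a, b]) `|f x| <=
      \int[mu]_(x in `[a, b]) (t / 2 + (2 * t)^-1 * f x ^+ 2).
    apply: le_Rintegral => //.
    - exact/integrable_norm_itv/square_integrable_integrable.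
    - by have := integrableD _ (integrable_cst_itv a b (t / 2)) i2; apply.
    - move=> x _; rewrite -(real_normK (num_real (f x))) -subr_ge0.
      rewrite (_ : _ - _ = (2 * t)^-1 * (t - `|f x|) ^+ 2); last by field; rewrite gt_eqF.
      by rewrite mulr_ge0 ?sqr_ge0 // invr_ge0 mulr_ge0 // ltW.
  move/le_trans; apply; rewrite RintegralD //; last exact: integrable_cst_itv.
  rewrite Rintegral_cst // (itv_volume (ltW hab)) RintegralZl //.
  have -> : \int[mu]_(x in `[a, b]) (f x ^+ 2) = inner a b f f.
    by apply: eq_Rintegral => x _; rewrite expr2.
  have : (2 * t)^-1 * inner a b f f <= (2 * t)^-1 * t ^+ 2.
    rewrite ler_wpM2l ?invr_ge0 ?mulr_ge0 ?(ltW t0) // (le_trans innS) //.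
    by rewrite ler_sqr ?nnegrE // ltW.
  have -> : (2 * t)^-1 * t ^+ 2 = t / 2 by field; rewrite gt_eqF.
  by move=> H; lra.
have K0 : 0 < (b - a + 1) / 2 by lra.
apply/ler_addgt0Pr => e e0.
have -> : (b - a + 1) / 2 * S + e = (b - a + 1) / 2 * (S + e / ((b - a + 1) / 2)).
  by rewrite mulrDr [X in _ = _ + X]mulrC divfK // gt_eqF.
have e'0 : 0 < e / ((b - a + 1) / 2) by rewrite divr_gt0.
by apply: main; rewrite ?ltr_wpDl // lerDl ltW.
Qed.

Lemma primitive_between f g c x : mu.-integrable `[a, b] (EFin \o g) ->
  (forall x, x \in `[a, b] -> f x = f a + \int[mu]_(t in `[a, x]) g t) ->
  a <= c -> c <= x -> x <= b -> f x = f c + \int[mu]_(t in `[c, x]) g t.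
Proof.
move=> ig fg ac cx xb.
have sub u v : a <= u -> v <= b -> mu.-integrable `[u, v] (EFin \o g).
  by move=> au vb; apply: integrableS ig => //; apply: subset_itv; rewrite bnd_simp.
rewrite (fg x) ?in_itv /= ?(le_trans ac) // (fg c) ?in_itv /= ?ac ?(le_trans cx) //.
have := Rintegral_itvB (sub _ _ (lexx a) xb) (x := c); rewrite !bnd_simp => /(_ ac cx).
rewrite Rintegral_itv_obnd_cbnd; first by move=> <-; ring.
by apply: integrableS (sub _ _ ac xb) => //; apply: subset_itvr; rewrite bnd_simp.
Qed.

(** For every [y], [`|f x|] is at most [`|f y|] plus twice the L1 norm of [g];
    average over [y]. *)
Lemma sup_le_l1norms f g x : mu.-integrable `[a, b] (EFin \o f) ->
  mu.-integrable `[a, b] (EFin \o g) ->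
  (forall x, x \in `[a, b] -> f x = f a + \int[mu]_(t in `[a, x]) g t) ->
  a <= x <= b ->
  `|f x| <= (\int[mu]_(t in `[a, b]) `|f t|) / (b - a)
            + 2 * \int[mu]_(t in `[a, b]) `|g t|.
Proof.
move=> fi gi fg axb; set G := \int[mu]_(t in `[a, b]) `|g t|.
have part y : a <= y <= b -> `|\int[mu]_(t in `[a, y]) g t| <= G.
  move=> /andP[ay yb].
  have gy : mu.-integrable `[a, y] (EFin \o g).
    by apply: integrableS gi => //; apply: subset_itvl; rewrite bnd_simp.
  rewrite (le_trans (le_normr_Rintegral _ gy)) // /G -subr_ge0.
  rewrite Rintegral_itvB ?bnd_simp //; last exact: integrable_norm_itv.
  exact: Rintegral_ge0.
have ba0 : 0 < b - a by rewrite subr_gt0.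
rewrite -lerBlDr ler_pdivlMr //.
rewrite -(itv_volume (ltW hab)) -Rintegral_cst //; apply: le_Rintegral => //.
- exact: integrable_cst_itv.
- exact: integrable_norm_itv.
- move=> y; rewrite /= in_itv /= => ayb; rewrite lerBlDr.
  have -> : f x = f y + (\int[mu]_(t in `[a, x]) g t - \int[mu]_(t in `[a, y]) g t).
    by rewrite (fg x) ?in_itv // (fg y) ?in_itv //; ring.
  rewrite (le_trans (ler_normD _ _)) // lerD2l (le_trans (ler_normB _ _)) //.
  by rewrite mulr_natl mulr2n lerD ?part.
Qed.

Definition sobolev_const : R := (b - a + 1) / 2 / (b - a) + 2 * ((b - a + 1) / 2).

Lemma sobolev_const_ge0 : 0 <= sobolev_const.
Proof.
have h : 0 <= b - a by rewrite subr_ge0 ltW.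
have h2 : 0 <= (b - a + 1) / 2 by lra.
rewrite /sobolev_const addr_ge0 //; first by rewrite divr_ge0.
by rewrite mulr_ge0.
Qed.

Section Derivatives.
Variables (m : nat) (w : R -> R) (dw : nat -> R -> R).
Hypothesis hw : periodic_sobolev a b m w dw.

Lemma l2norm_le_sobolev j : (j <= m)%N -> l2norm a b (dw j) <= sobolev_norm a b m dw.
Proof.
rewrite -ltnS => jm; rewrite -[l2norm _ _ _]ger0_norm ?sqrtr_ge0 // -sqrtr_sqr.
apply: ler_wsqrtr; rewrite (bigD1 (Ordinal jm)) //= lerDl.
by apply: sumr_ge0 => i _; exact: sqr_ge0.
Qed.

Lemma derivative_integrable j : (j <= m)%N -> mu.-integrable `[a, b] (EFin \o dw j).
Proof. by have [_ sq _] := hw => jm; exact/square_integrable_integrable/sq. Qed.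

(** The order [m] itself is excluded: the last derivative is only square integrable. *)
Lemma derivative_sup j x : (j < m)%N -> a <= x <= b ->
  `|dw j x| <= sobolev_const * sobolev_norm a b m dw.
Proof.
have [_ sq pp] := hw => jm axb.
have [_ fg] := pp j jm.
have := sup_le_l1norms (derivative_integrable (ltnW jm)) (derivative_integrable jm) fg axb.
have h1 := l1norm_le_l2norm (sq j (ltnW jm)) (l2norm_le_sobolev (ltnW jm)).
have h2 := l1norm_le_l2norm (sq j.+1 jm) (l2norm_le_sobolev jm).
move/le_trans; apply.
set K := (b - a + 1) / 2 in h1 h2; set S := sobolev_norm _ _ _ _ in h1 h2 *.
have -> : sobolev_const * S = K * S / (b - a) + 2 * (K * S).
  by rewrite /sobolev_const -/K; ring.
rewrite lerD //; last by rewrite ler_wpM2l.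
by rewrite ler_wpM2r // invr_ge0 subr_ge0 ltW.
Qed.

Lemma derivative_bounded_measurable j : (j < m)%N -> bounded_measurable `[a, b] (dw j).
Proof.
have [_ sq _] := hw => jm; split; first by have [] := sq j (ltnW jm).
exists (sobolev_const * sobolev_norm a b m dw) => x; rewrite /= in_itv /=.
exact: derivative_sup.
Qed.

Lemma derivative_primitive j c x : (j < m)%N -> a <= c -> c <= x -> x <= b ->
  dw j x = dw j c + \int[mu]_(t in `[c, x]) dw j.+1 t.
Proof.
have [_ _ pp] := hw => jm; apply: primitive_between; first exact: derivative_integrable.
by have [] := pp j jm.
Qed.

Lemma derivative_mean0 j : (j < m)%N -> \int[mu]_(t in `[a, b]) dw j.+1 t = 0.
Proof.
have [_ _ pp] := hw => jm; have [per fg] := pp j jm.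
have := fg b; rewrite in_itv /= lexx ltW // -per => /(_ isT) H.
by apply: (addrI (dw j a)); rewrite addr0 -H.
Qed.

Lemma derivative_taylor n j c d : (j + n < m)%N -> a <= c -> c <= d -> d <= b ->
  exists2 T : {poly R}, (size T <= n)%N & forall x, c <= x <= d ->
    `|dw j x - T.[x]| <= sobolev_const * sobolev_norm a b m dw * (d - c) ^+ n.
Proof.
move=> jnm ac cd db.
have := @taylor_approx R n (fun i => dw (j + i)%N) c d
  (sobolev_const * sobolev_norm a b m dw) cd.
rewrite addn0; apply.
- move=> i lt_in; apply: integrableS (derivative_integrable (j := j + i.+1) _) => //.
    by apply: subset_itv; rewrite bnd_simp.
  by rewrite ltnW // (leq_ltn_trans _ jnm) // leq_add2l.
- move=> i lt_in x /andP[cx xd]; rewrite addnS; apply: derivative_primitive => //.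
    by rewrite (ltn_trans _ jnm) // ltn_add2l.
  exact: le_trans db.
- move=> x /andP[cx xd]; apply: derivative_sup => //.
  by rewrite (le_trans ac cx) (le_trans xd db).
Qed.

End Derivatives.
End SobolevBounds.

(** * Composing the inverse operators *)

Section Chain.
Context {R : realType} (a b : R) (k : nat).
Hypothesis hab : a < b.
Local Notation mu := (@lebesgue_measure R).

(** The projection reproduces [T] and is bounded on the remainder [f - T].  Testing
    with constants shows that it preserves the integral over each cell. *)
Lemma Pi0_error : exists2 C : R, 0 <= C &
  forall (N : nat) (xs : nat -> R) (f : R -> R) (T : 'I_N -> {poly R}) (E : R),
  is_mesh a b N xs -> bounded_measurable `[a, b] f ->
  (forall i, (size (T i) <= k.+1)%N) ->
  (forall (i : 'I_N) x, xs i <= x <= xs i.+1 -> `|f x - (T i).[x]| <= E) ->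
  let z := Pi0 a b k N xs f in
  (forall i : 'I_N,
     pint (xs i) (xs i.+1) (z i : {poly R}) = \int[mu]_(x in `[xs i, xs i.+1]) f x) /\
  forall (i : 'I_N) x, xs i <= x <= xs i.+1 -> `|f x - (z i : {poly R}).[x]| <= C * E.
Proof.
have [C C0 proj] := @projection_local R k.
exists (1 + C); first by rewrite addr_ge0.
move=> N xs f T E hm bf sT fT /=; have lt_xs := mesh_lt hm.
have bfi (i : 'I_N) : bounded_measurable `[xs i, xs i.+1] f.
  by apply: bounded_measurableS bf => //; exact: subset_cell.
have bfT (i : 'I_N) : bounded_measurable `[xs i, xs i.+1] (fun x => f x - (T i).[x]).
  apply: bounded_measurableD (bfi i) _; apply: bounded_measurableN.
  exact: bounded_measurable_horner.
have /fin_all_exists[Q QP] (i : 'I_N) := proj _ _ _ E (lt_xs i) (proj1 (bfT i)) (fT i).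
pose z : Vh R k N := [ffun i => npolyp k.+1 (T i + Q i)].
have zE i : (z i : {poly R}) = T i + Q i.
  rewrite ffunE npolypK // (leq_trans (size_polyD _ _)) // geq_max sT.
  by have [-> _ _] := QP i.
have zint (i : 'I_N) (v : {poly R}) : (size v <= k.+1)%N ->
    pint (xs i) (xs i.+1) ((z i : {poly R}) * v) =
    \int[mu]_(x in `[xs i, xs i.+1]) (f x * v.[x]).
  move=> sv; have [_ Qv _] := QP i.
  rewrite zE mulrDl linearD /= -Qv // -Rintegral_horner ?ltW //.
  have bv := @bounded_measurable_horner _ (xs i) (xs i.+1) v.
  rewrite -RintegralD //.
  - by apply: eq_Rintegral => x _; rewrite hornerM -mulrDl addrC subrK.
  - exact: integrable_horner.
  - by apply: bounded_measurable_integrable; exact: bounded_measurableM (bfT i) bv.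
have -> : Pi0 a b k N xs f = z.
  apply: (riesz_eq hm) => v; rewrite /vfun (inner_pw hm) //.
  by apply: eq_bigr => i _; rewrite zint // size_npoly.
split=> [i|i x xi].
  have := zint i 1; rewrite mulr1 size_poly1 => -> //.
  by apply: eq_Rintegral => x _; rewrite hornerC mulr1.
have [_ _ QE] := QP i.
rewrite zE hornerD opprD addrA (le_trans (ler_normB _ _)) // mulrDl mul1r.
by rewrite lerD ?fT ?QE.
Qed.

Section Primitives.
Variables (N : nat) (xs : nat -> R) (w f : R -> R) (z : Vh R k N) (E : R).
Hypotheses (hm : is_mesh a b N xs) (fi : mu.-integrable `[a, b] (EFin \o f))
  (wf : forall c x, a <= c -> c <= x -> x <= b ->
          w x = w c + \int[mu]_(t in `[c, x]) f t)
  (fz : forall (i : 'I_N) x, xs i <= x <= xs i.+1 ->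
          `|f x - (z i : {poly R}).[x]| <= E).

Lemma cell_in (i : 'I_N) : a <= xs i /\ xs i.+1 <= b.
Proof.
have [xa xb _] := hm; have lt_i := ltn_ord i.
by rewrite -xa -xb !(mesh_le hm) ?lt_i ?leqnn //= ltnW.
Qed.

Lemma primitive_error_cell (i : 'I_N) x : xs i <= x <= xs i.+1 ->
  `|w x - w (xs i) - ((primitive xs z i).[x] - node_integral xs z i)| <= E * (x - xs i).
Proof.
move=> xi; have [ai ib] := cell_in i; rewrite -primitive_left.
apply: (@primitive_approx _ w f (xs i) (xs i.+1)) => //.
- by apply: integrableS fi => //; apply: subset_itv; rewrite bnd_simp.
- by move=> y /andP[iy yi]; apply: wf => //; exact: le_trans ib.
- by move=> y yi; rewrite deriv_primitive; exact: fz.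
Qed.

(** The error accumulates over the cells on the left of [x]. *)
Lemma primitive_error (i : 'I_N) x : xs i <= x <= xs i.+1 ->
  `|w x - w a - (primitive xs z i).[x]| <= E * (x - a).
Proof.
have [xa _ _] := hm.
have node n : (n <= N)%N -> `|w (xs n) - w a - node_integral xs z n| <= E * (xs n - a).
  elim: n => [|n IH] nN; first by rewrite xa node_integral0 !subrr normr0 mulr0.
  have := IH (ltnW nN); pose i0 := Ordinal nN.
  have := @primitive_error_cell i0 (xs n.+1);
  rewrite lexx ltW ?(mesh_lt hm i0) //= => /(_ isT).
  rewrite primitive_right => h1 h2.
  rewrite (_ : _ - _ = w (xs n.+1) - w (xs n)
     - (node_integral xs z n.+1 - node_integral xs z n)
     + (w (xs n) - w a - node_integral xs z n)); last by ring.
  rewrite (le_trans (ler_normD _ _)) // (le_trans (lerD h1 h2)) // -mulrDr.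
  by rewrite /= addrA subrK.
move=> xi; have h1 := primitive_error_cell xi; have h2 := node i (ltnW (ltn_ord i)).
rewrite (_ : _ - _ = w x - w (xs i) - ((primitive xs z i).[x] - node_integral xs z i)
     + (w (xs i) - w a - node_integral xs z i)); last by ring.
by rewrite (le_trans (ler_normD _ _)) // (le_trans (lerD h1 h2)) // -mulrDr addrA subrK.
Qed.

(** When [z] has the same cell integrals as [f], the error restarts from zero at
    each node, so that one cell length replaces [x - a]. *)
Lemma primitive_error_exact_nodes (i : 'I_N) x :
  (forall i : 'I_N, pint (xs i) (xs i.+1) (z i : {poly R}) =
     \int[mu]_(t in `[xs i, xs i.+1]) f t) ->
  xs i <= x <= xs i.+1 ->
  `|w x - w a - (primitive xs z i).[x]| <= E * (x - xs i).
Proof.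
have [xa _ _] := hm => zf.
have node n : (n <= N)%N -> node_integral xs z n = w (xs n) - w a.
  elim: n => [|n IH] nN; first by rewrite xa node_integral0 subrr.
  have [ai ib] := cell_in (Ordinal nN).
  have zS : node_integral xs z n.+1 =
      node_integral xs z n + \int[mu]_(t in `[xs n, xs n.+1]) f t.
    by rewrite -(zf (Ordinal nN)); exact: (node_integralS xs z (Ordinal nN)).
  have wS := wf ai (ltW (mesh_lt hm (Ordinal nN))) ib.
  by rewrite zS (IH (ltnW nN)) wS /=; ring.
move=> xi; have := primitive_error_cell xi; rewrite (node i (ltnW (ltn_ord i))).
by apply: le_trans; rewrite le_eqVlt; apply/orP; left; apply/eqP; congr `|_|; ring.
Qed.

End Primitives.

Variables (q : nat).
Hypothesis hq : (1 <= q)%N.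
Local Notation m := (k + 1 + q)%N.

Definition iter_Dinv (N : nat) (xs : nat -> R) (ts : seq R) (z : Vh R k N) : Vh R k N :=
  foldl (fun u t => Dinv a b xs t u) z ts.

(** Accuracy of the primitive of [z] for the [j]-th derivative becomes uniform
    accuracy of [Dinv t z] for that derivative minus its mean. *)
Lemma Dinv_chain_step (t : R) (C : R) j : (j < q)%N -> t <> 2^-1 -> 0 <= C ->
  exists2 C' : R, 0 <= C' &
  forall (N : nat) (xs : nat -> R) (w : R -> R) (dw : nat -> R -> R) (z : Vh R k N),
  is_mesh a b N xs -> periodic_sobolev a b m w dw -> Zh a b xs z ->
  (forall (i : 'I_N) x, xs i <= x <= xs i.+1 ->
     `|dw j x - dw j a - (primitive xs z i).[x]|
       <= C * sobolev_norm a b m dw * mesh_size N xs ^+ k.+1) ->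
  Zh a b xs (Dinv a b xs t z) /\
  forall (i : 'I_N) x, xs i <= x <= xs i.+1 ->
    `|dw j x - mean a b (dw j) - (Dinv a b xs t z i : {poly R}).[x]|
       <= C' * sobolev_norm a b m dw * mesh_size N xs ^+ k.+1.
Proof.
move=> jq th C0; have [C1 C1_0 step] := inverse_step k th.
exists (C1 * (sobolev_const a b + C)).
  by rewrite mulr_ge0 // addr_ge0 // sobolev_const_ge0.
move=> N xs w dw z hm hw Zz zE.
set S := sobolev_norm a b m dw in zE *; set h := mesh_size N xs in zE *.
have S0 : 0 <= S by exact: sqrtr_ge0.
have jm : (j + k.+1 < m)%N by rewrite addn1 addnC ltn_add2l.
have /fin_all_exists2[T sT TE] (i : 'I_N) :
    exists2 T : {poly R}, (size T <= k.+1)%N & forall x, xs i <= x <= xs i.+1 ->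
    `|dw j x - T.[x]| <= sobolev_const a b * S * h ^+ k.+1.
  have [ai ib] := cell_in hm i; have lt_i := mesh_lt hm i.
  have [T sT TE] := derivative_taylor hab hw jm ai (ltW lt_i) ib.
  exists T => // x xi; apply: le_trans (TE x xi) _; rewrite ler_wpM2l //.
    by rewrite mulr_ge0 // sobolev_const_ge0.
  by rewrite lerXn2r ?nnegrE ?subr_ge0 ?(ltW lt_i) ?mesh_size_ge0 // mesh_size_ge.
have := step a b N xs (dw j) z (fun i => T i - (dw j a)%:P)
  (sobolev_const a b * S * h ^+ k.+1) (C * S * h ^+ k.+1) hab hm _ Zz _ _ zE.
rewrite -!mulrDl !mulrA; apply.
- by apply: derivative_integrable hw _ _; rewrite ltnW // (leq_ltn_trans _ jm) // leq_addr.
- move=> i; rewrite (leq_trans (size_polyD _ _)) // geq_max sT size_polyN.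
  by rewrite (leq_trans (size_polyC_leq1 _)).
- move=> i x xi; rewrite hornerD hornerN hornerC.
  by rewrite (_ : _ - _ = dw j x - (T i).[x]) ?TE //; ring.
Qed.

(** After [size ts] inversions the primitive of the iterate approximates the
    derivative of order [q - 1 - size ts].  Tracking primitives rather than the
    iterates makes the estimate hold with the full power of [h] from the start. *)
Lemma Dinv_chain (ts : seq R) : (size ts < q)%N ->
  (forall t, t \in ts -> t <> 2^-1) -> exists2 C : R, 0 <= C &
  forall (N : nat) (xs : nat -> R) (w : R -> R) (dw : nat -> R -> R),
  is_mesh a b N xs -> periodic_sobolev a b m w dw ->
  let z := iter_Dinv xs ts (Pi0 a b k N xs (dw q)) in
  let j := (q.-1 - size ts)%N in
  Zh a b xs z /\
  forall (i : 'I_N) x, xs i <= x <= xs i.+1 ->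
     `|dw j x - dw j a - (primitive xs z i).[x]|
       <= C * sobolev_norm a b m dw * mesh_size N xs ^+ k.+1.
Proof.
elim/last_ind: ts => [|ts t IH].
  move=> _ _; have [C C0 proj] := Pi0_error; exists (C * sobolev_const a b).
    by rewrite mulr_ge0 // sobolev_const_ge0.
  move=> N xs w dw hm hw; rewrite /= subn0.
  set S := sobolev_norm a b m dw; set h := mesh_size N xs.
  have S0 : 0 <= S by exact: sqrtr_ge0.
  have qS : q.-1.+1 = q by rewrite prednK.
  have qm : (q + k < m)%N by rewrite addn1 addnC ltn_add2r.
  have qm1 : (q.-1 < m)%N by rewrite qS ltnW // (leq_ltn_trans _ qm) // leq_addr.
  have /fin_all_exists2[T sT TE] (i : 'I_N) :
      exists2 T : {poly R}, (size T <= k)%N & forall x, xs i <= x <= xs i.+1 ->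
      `|dw q x - T.[x]| <= sobolev_const a b * S * h ^+ k.
    have [ai ib] := cell_in hm i; have lt_i := mesh_lt hm i.
    have [T sT TE] := derivative_taylor hab hw qm ai (ltW lt_i) ib.
    exists T => // x xi; apply: le_trans (TE x xi) _; rewrite ler_wpM2l //.
      by rewrite mulr_ge0 // sobolev_const_ge0.
    by rewrite lerXn2r ?nnegrE ?subr_ge0 ?(ltW lt_i) ?mesh_size_ge0 // mesh_size_ge.
  have bq : bounded_measurable `[a, b] (dw q).
    by apply: derivative_bounded_measurable hw _ _; rewrite // (leq_ltn_trans _ qm) // leq_addr.
  have [|zint zE] := proj N xs (dw q) T _ hm bq _ TE; first by move=> i; exact: leqW.
  split.
    apply/(ZhE hm); under eq_bigr do rewrite zint.
    rewrite -(Rintegral_mesh hm); last exact: bounded_measurable_integrable.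
    by rewrite -qS; apply: derivative_mean0 hw _ qm1.
  move=> i x xi.
  have := @primitive_error_exact_nodes N xs (dw q.-1) (dw q) _ _ hm
    (bounded_measurable_integrable bq) _ zE i x zint xi.
  move=> /(_ _)/le_trans; apply.
    by move=> c y ac cy yb; rewrite -qS; apply: (derivative_primitive hw).
  rewrite -!mulrA exprSr !mulrA ler_wpM2l //.
    by rewrite !mulr_ge0 // ?sobolev_const_ge0 // exprn_ge0 // mesh_size_ge0.
  have /andP[_ xr] := xi; apply: le_trans (mesh_size_ge xs i).
  by rewrite lerD2r.
rewrite size_rcons => lt_q ts_half.
have [||C C0 CP] := IH; first exact: ltnW.
  by move=> s s_ts; apply: ts_half; rewrite mem_rcons inE s_ts orbT.
have jE : (q.-1 - size ts = (q.-1 - (size ts).+1).+1)%N.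
  by rewrite -subSn ?subSS // -ltnS prednK.
set j' := (q.-1 - (size ts).+1)%N in jE *.
have jq : (j'.+1 < q)%N by rewrite -jE (leq_ltn_trans (leq_subr _ _)) // prednK.
have th : t <> 2^-1 by apply: ts_half; rewrite mem_rcons inE eqxx.
have [C1 C1_0 step] := Dinv_chain_step jq th C0.
exists (C1 * (b - a)); first by rewrite mulr_ge0 // subr_ge0 ltW.
move=> N xs w dw hm hw z j; rewrite /z /iter_Dinv -cats1 foldl_cat /=.
have [Zz zE] := CP N xs w dw hm hw; rewrite jE in zE.
have [Zz' zE'] := step N xs w dw _ hm hw Zz zE.
split=> //; rewrite {}/j.
have jm i : (i <= j'.+1)%N -> (i < m)%N.
  by move=> ij; rewrite (leq_trans (leq_ltn_trans ij jq)) // leq_addl.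
have mean0 : mean a b (dw j'.+1) = 0.
  by rewrite meanE // (derivative_mean0 hab hw) ?mul0r // jm.
pose E := C1 * sobolev_norm a b m dw * mesh_size N xs ^+ k.+1.
have {}zE' (i : 'I_N) x : xs i <= x <= xs i.+1 ->
    `|dw j'.+1 x - (Dinv a b xs t (iter_Dinv xs ts (Pi0 a b k N xs (dw q))) i
        : {poly R}).[x]| <= E.
  by move=> xi; have := zE' i x xi; rewrite mean0 subr0.
move=> i x xi.
have := @primitive_error N xs (dw j') (dw j'.+1) _ _ hm _ _ zE' i x xi.
move=> /(_ _ _)/le_trans; apply.
- by apply: derivative_integrable hw _ _; rewrite ltnW // jm.
- by move=> c y ac cy yb; apply: (derivative_primitive hw); rewrite // jm.
have /andP[ax xb] := cell_sub hm xi.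
rewrite [leRHS](_ : _ = E * (b - a)); last by rewrite /E; ring.
rewrite ler_wpM2l ?lerD2r // !mulr_ge0 ?sqrtr_ge0 // exprn_ge0 //.
exact: mesh_size_ge0.
Qed.

Lemma l2norm_le_sup (f : R -> R) (E : R) : bounded_measurable `[a, b] f -> 0 <= E ->
  (forall x, a <= x < b -> `|f x| <= E) -> l2norm a b f <= Num.sqrt (b - a) * E.
Proof.
move=> bf E0 fE; rewrite /l2norm -[E]ger0_norm // -sqrtr_sqr -sqrtrM ?subr_ge0 ?(ltW hab) //.
apply: ler_wsqrtr; rewrite /inner.
have co g : bounded_measurable `[a, b] g -> mu.-integrable `[a, b[ (EFin \o g).
  move=> bg; apply: integrableS (bounded_measurable_integrable bg) => //.
  by apply: subset_itvl; rewrite bnd_simp.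
have bff := bounded_measurableM bf bf.
have bE := bounded_measurable_cst `[a, b] (E ^+ 2).
rewrite -Rintegral_itv_bndo_bndc; last exact: co.
rewrite mulrC -(itv_volume (ltW hab)) -Rintegral_cst //.
rewrite -Rintegral_itv_bndo_bndc; last exact: co.
apply: le_Rintegral => //; [exact: co|exact: co|].
move=> x; rewrite /= in_itv /= => /fE fx.
by rewrite -expr2 -(real_normK (num_real (f x))) lerXn2r ?nnegrE.
Qed.

(** Listed in the order in which the inverse operators act. *)
Definition Pi_op_thetas (theta : nat -> R) : seq R :=
  [seq 1 - theta i | i <- rev (iota 1 q./2)] ++
  (if odd q then [:: theta 0%N] else [::]) ++ [seq theta i | i <- iota 1 q./2].

Lemma Pi_opE (N : nat) (xs : nat -> R) theta (w wq : R -> R) x :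
  Pi_op a b k N xs q theta w wq x =
  vfun xs (iter_Dinv xs (Pi_op_thetas theta) (Pi0 a b k N xs wq)) x + mean a b w.
Proof.
have foldl_map (f : nat -> R) s (z : Vh R k N) :
    foldl (fun u t => Dinv a b xs t u) z [seq f i | i <- s] =
    foldl (fun u i => Dinv a b xs (f i) u) z s.
  by elim: s z => //=.
rewrite /Pi_op /iter_Dinv /Pi_op_thetas /Dinv_prod /Dinv_conj !foldl_cat.
rewrite !foldl_map foldl_rev.
by case: (odd q).
Qed.

Lemma size_Pi_op_thetas theta : size (Pi_op_thetas theta) = q.
Proof.
rewrite /Pi_op_thetas !size_cat !size_map size_rev size_iota.
by rewrite -[RHS](odd_double_half q) -addnn; case: (odd q); rewrite /= ?addnS ?addSn.
Qed.

Lemma Pi_op_thetas_half theta : (forall i, (i <= q./2)%N -> theta i <> 2^-1) ->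
  forall t, t \in Pi_op_thetas theta -> t <> 2^-1.
Proof.
move=> th t; rewrite !mem_cat => /or3P[/mapP[i]|t0|/mapP[i]].
- rewrite mem_rev mem_iota add1n ltnS => /andP[_ ig] ->.
  by have := th i ig; lra.
- by move: t0; case: (odd q) => //; rewrite inE => /eqP ->; exact: th.
- by rewrite mem_iota add1n ltnS => /andP[_ ig] ->; exact: th.
Qed.

End Chain.

Unset Implicit Arguments.

Theorem theorem4p1 (R : realType) (a b : R) (hab : a < b) (k q : nat)
    (hq : (1 <= q)%N) (theta : nat -> R)
    (htheta : forall i : nat, (i <= q./2)%N -> theta i <> 2^-1)
    (sigma : R) :
  exists C : R, forall (N : nat) (xs : nat -> R),
    is_mesh a b N xs -> quasi_uniform N xs sigma ->
    forall (w : R -> R) (dw : nat -> R -> R),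
      periodic_sobolev a b (k + 1 + q) w dw ->
      l2norm a b (fun x => w x - Pi_op a b k N xs q theta w (dw q) x)
        <= C * sobolev_norm a b (k + 1 + q) dw * mesh_size N xs ^+ (k + 1).
Proof.
have ts_half := Pi_op_thetas_half htheta; have ts_size := size_Pi_op_thetas q theta.
set ts := Pi_op_thetas q theta in ts_half ts_size.
have [ts' [t tsE]] : exists ts' t, ts = rcons ts' t.
  by case/lastP: (ts) ts_size => [q0|ts' t _]; [rewrite -q0 in hq | exists ts', t].
have sz : size ts' = q.-1 by rewrite -ts_size tsE size_rcons.
have th : t <> 2^-1 by apply: ts_half; rewrite tsE mem_rcons inE eqxx.
have [||C0 C0_0 chain] := @Dinv_chain R a b k hab q hq ts'.
- by rewrite sz prednK.
- by move=> s s_ts; apply: ts_half; rewrite tsE mem_rcons inE s_ts orbT.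
have [C C_0 step] := @Dinv_chain_step R a b k hab q t C0 0 hq th C0_0.
exists (Num.sqrt (b - a) * C) => N xs hm _ w dw hw.
have [Zz zE] := chain N xs w dw hm hw; rewrite sz subnn in zE.
have [_ uE] := step N xs w dw _ hm hw Zz zE.
have [dw0 _ _] := hw; rewrite dw0 in uE.
rewrite -!mulrA [X in _ ^+ X]addn1; apply: l2norm_le_sup => //.
- apply: bounded_measurableD.
    rewrite -dw0; apply: derivative_bounded_measurable hab _ _ _ hw _ _.
    by rewrite addn1 addSn.
  apply: bounded_measurableN.
  rewrite [X in bounded_measurable _ X](funext (Pi_opE _ _ _ _ _ _ _ _ _)).
  apply: bounded_measurableD (bounded_measurable_cst _ _).
  exact: bounded_measurable_pw.
- rewrite !mulr_ge0 ?sqrtr_ge0 // exprn_ge0 //; exact: mesh_size_ge0.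
- move=> x axb; have [i xi] := mesh_cell hm axb.
  rewrite Pi_opE -/ts tsE /iter_Dinv -cats1 foldl_cat /= /vfun (pw_cell hm _ xi).
  have /andP[ix xi'] := xi.
  have := uE i x; rewrite ix ltW // mulrA => /(_ isT).
  by rewrite /iter_Dinv opprD addrA addrAC.
Qed.
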